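(* Let $\mathcal{B}\subseteq\mathcal{M}$ be a unital inclusion of type $\mathrm{II}_1$ factors. If $\mathcal{B}$ is regular in $\mathcal{M}$, then $\mathcal{B}$ is unitarily regular in $\mathcal{M}$.
   Context: For a unital inclusion of von Neumann algebras $\mathcal{B}\subseteq\mathcal{M}$ (i.e. $1_{\mathcal{B}}=1_{\mathcal{M}}$), put $\mathcal{N}_{\mathcal{M}}(\mathcal{B})=\{n\in\mathcal{M}: n\mathcal{B}n^*\cup n^*\mathcal{B}n\subseteq\mathcal{B}\}$ (the normaliser) and $\mathcal{UN}_{\mathcal{M}}(\mathcal{B})=\{u\in\mathcal{M}\text{ unitary}: u\mathcal{B}u^*=\mathcal{B}\}$ (the unitary normaliser). $W^*(S)$ denotes the von Neumann subalgebra of $\mathcal{M}$ generated by $S$. $\mathcal{B}$ is regular in $\mathcal{M}$ if $W^*(\mathcal{N}_{\mathcal{M}}(\mathcal{B}))=\mathcal{M}$ and unitarily regular in $\mathcal{M}$ if $W^*(\mathcal{UN}_{\mathcal{M}}(\mathcal{B}))=\mathcal{M}$. *)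

(* Defs.v *)
From HB Require Import structures.
From mathcomp Require Import all_boot all_order all_algebra.
From mathcomp Require Import complex.
From mathcomp Require Import all_classical all_reals all_analysis.

Set Implicit Arguments.
Unset Strict Implicit.
Unset Printing Implicit Defensive.

Import Order.TTheory GRing.Theory Num.Theory.
Import numFieldNormedType.Exports.

Local Open Scope classical_set_scope.
Local Open Scope complex_scope.
Local Open Scope ring_scope.

(* Complex Hilbert spaces, not assumed separable.  The inner product is linear
   in its first argument and conjugate-linear in its second one. *)
HB.mixin Record CompleteNormedModule_isHilbert (R : realType) (H : Type)
    & CompleteNormedModule R[i] H := {
  hdot : {dot H for Num.conj} ;
  hdot_norm : forall x : H, `|x| ^+ 2 = hdot x x
}.

#[short(type="hilbertType")]
HB.structure Definition Hilbert (R : realType) :=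
  {H of CompleteNormedModule R[i] H & CompleteNormedModule_isHilbert R H}.

(* Operators are plain functions H -> H, multiplied by composition; B(H) is the
   set bounded_op of the continuous linear ones. *)
Section Operators.
Context {R : realType} {H : hilbertType R}.
Implicit Types (T U V n u b e f p : H -> H) (S M B P : set (H -> H)).

Definition bounded_op : set (H -> H) := [set T | linear T /\ continuous T].

Definition is_adjoint T U : Prop :=
  bounded_op U /\ forall x y : H, hdot (T x) y = hdot x (U y).

(* For T in B(H) an adjoint exists (Riesz) and is unique, so that adj T is T^*;
   the default value idfun only concerns functions outside B(H). *)
Definition adj T : H -> H := xget (idfun : H -> H) [set U | is_adjoint T U].

Definition commutant S : set (H -> H) :=
  [set T | bounded_op T /\ forall U, S U -> T \o U = U \o T].

(* A *-closed set of bounded operators which equals its bicommutant.  It contains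
   the identity of H, so an inclusion of two such algebras is always unital. *)
Definition von_neumann_algebra M : Prop :=
  [/\ M `<=` bounded_op,
      (forall T, M T -> M (adj T)) &
      commutant (commutant M) = M].

Definition vN_generated M S : set (H -> H) :=
  \bigcap_(P in [set P | [/\ von_neumann_algebra P, S `<=` P & P `<=` M]]) P.

Definition scalar_ops : set (H -> H) :=
  [set T | exists c : R[i], T = (fun x : H => c *: x)].

(* The first condition excludes the zero Hilbert space, i.e. requires 1 <> 0. *)
Definition factor M : Prop :=
  [/\ exists x : H, x != 0,
      von_neumann_algebra M &
      M `&` commutant M = scalar_ops].

Definition projection_in M p : Prop := [/\ M p, p \o p = p & adj p = p].

(* Murray-von Neumann equivalence e ~ f relative to M. *)
Definition mvn_equiv M e f : Prop :=
  exists2 v : H -> H, M v & adj v \o v = e /\ v \o adj v = f.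

(* The equation e \o f = f expresses f <= e for projections. *)
Definition finite_projection M e : Prop :=
  projection_in M e /\
  forall f, projection_in M f -> e \o f = f -> mvn_equiv M e f -> f = e.

Definition abelian_projection M p : Prop :=
  projection_in M p /\
  forall U V, M U -> M V ->
    (p \o U \o p) \o (p \o V \o p) = (p \o V \o p) \o (p \o U \o p).

(* Type II_1 in the Murray-von Neumann classification: the identity is a finite
   projection and there is no nonzero abelian projection. *)
Definition type_II1 M : Prop :=
  finite_projection M idfun /\
  forall p, abelian_projection M p -> p = (fun=> 0).

Definition II1_factor M : Prop := factor M /\ type_II1 M.

Definition unitary u : Prop := adj u \o u = idfun /\ u \o adj u = idfun.

Definition normaliser M B : set (H -> H) :=
  [set n | M n /\ forall b, B b -> B (n \o b \o adj n) /\ B (adj n \o b \o n)].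

Definition unitary_normaliser M B : set (H -> H) :=
  [set u | [/\ M u, unitary u & [set u \o b \o adj u | b in B] = B]].

Definition regular M B : Prop := vN_generated M (normaliser M B) = M.

Definition unitarily_regular M B : Prop :=
  vN_generated M (unitary_normaliser M B) = M.

End Operators.

(* Main.v *)
Require Import Defs.
From HB Require Import structures.
From mathcomp Require Import all_boot all_order all_algebra.
From mathcomp Require Import complex ring lra.
From mathcomp Require Import all_classical all_reals all_analysis.

(** Write x† for the adjoint of x.  Since B is regular, it suffices that a von
Neumann algebra P between the unitary normalisers and M contains each normaliser
n, i.e. that every T in the commutant of P commutes with n
([normaliser_commute]).

Write n = v h, the polar decomposition.  Both n† n and n n† belong to B, and v
is a strong limit of operators n g with g in B; hence v is again a normaliser of
B, and h = v† n is in B ([normaliser_polar]).  Unitaries of B normalise B, and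
they generate B ([commute_unitaries]), so T commutes with B and only v is left.

The partial isometry v extends to a unitary normaliser u, v = u (v† v)
([maximal_extension], [maximal_unitary]): Zorn's lemma gives a maximal partial
isometry z extending v in the normaliser.  If z is not unitary then, M being
finite, both z† z and z z† are proper projections of B.  As B is a factor,
there are non-zero partial isometries w and w1 in B, the first from a piece of
z† z into 1 - z† z, the second from a piece of z w† w z† into 1 - z z†.  Then
z + w1 z w† is a normaliser, because conjugating b by it only produces terms
such as w1 (z (w† b) z†), all in B; and it properly extends z.  Finiteness of M
enters through the fact that isometries of M are unitary.

The operator theory behind this is built from the completeness of H.  Existence
of adjoints and of projections onto closed subspaces comes from one variational
lemma ([riesz_on_closed_subspace]).  The polar decomposition is obtained by
an algebraic iteration ([polar_decomposition]): for a contraction X, the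
Newton-Schulz iteration X_(k+1) = X_k (3 - X_k† X_k) / 2 converges strongly to
the polar part of X.  Indeed s |-> s (3 - s^2) / 2 increases singular values in
]0, 1] to 1; algebraically, 1 - X_k† X_k stays in the cone of polynomials with
nonnegative coefficients in 1 - X† X, which makes the sequences of norms
|X_k y| increasing.  Each X_k is X times a polynomial in X† X, and this is what
lets normalisers, elements of B and commutation relations pass to the polar
part. *)

Set Implicit Arguments.
Unset Strict Implicit.
Unset Printing Implicit Defensive.

Import Order.TTheory GRing.Theory Num.Theory.
Import numFieldNormedType.Exports.

Local Open Scope classical_set_scope.
Local Open Scope complex_scope.
Local Open Scope ring_scope.

(** * The real inner product and real norm of a Hilbert space *)

Section RealInner.
Context {R : realType} {H : hilbertType R}.
Implicit Types (x y z : H) (c : R).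

(** The real part of the inner product.  An equation between values of [hdot]
follows from equations between values of [rip] ([hdot_rip]), and working over R
rather than R[i] keeps all estimates in a totally ordered field. *)
Definition rip x y : R := complex.Re (hdot x y).
Definition nr x : R := complex.Re `|x|.

Lemma nrE x : `|x| = (nr x)%:C.
Proof. by rewrite /nr RRe_real // normr_real. Qed.

Lemma nr_ge0 x : 0 <= nr x.
Proof. by rewrite -ler0c -nrE. Qed.

Lemma nr_sqr x : nr x ^+ 2 = rip x x.
Proof. by apply: complexI; rewrite rmorphXn /= -nrE hdot_norm /rip -hdot_norm nrE -rmorphXn. Qed.

Lemma nrD x y : nr (x + y) <= nr x + nr y.
Proof. by rewrite -lecR rmorphD /= -!nrE ler_normD. Qed.

Lemma nrN x : nr (- x) = nr x.
Proof. by rewrite /nr normrN. Qed.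

Lemma nr_eq0 x : nr x = 0 -> x = 0.
Proof. by move=> h; apply/normr0_eq0; rewrite nrE h. Qed.

Lemma nr0 : nr 0 = 0.
Proof. by rewrite /nr normr0. Qed.

Lemma nrZ (a : R[i]) x : nr (a *: x) = complex.Re `|a| * nr x.
Proof.
rewrite /nr normrZ nrE -{1}(RRe_real (normr_real a)).
by rewrite -rmorphM.
Qed.

Lemma nrZr c x : nr (c%:C *: x) = `|c| * nr x.
Proof. by rewrite nrZ normc_def /= expr0n addr0 sqrtr_sqr. Qed.

Lemma ripDl x y z : rip (x + y) z = rip x z + rip y z.
Proof. by rewrite /rip linearDl raddfD. Qed.

Lemma ripC x y : rip x y = rip y x.
Proof. by rewrite /rip hermC /= expr0 mul1r; case: (hdot y x). Qed.
Lemma ripZl c x z : rip (c%:C *: x) z = c * rip x z.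
Proof. by rewrite /rip linearZl_LR /=; case: (hdot x z) => a b /=; rewrite mul0r subr0. Qed.
Lemma ripil x z : rip ('i%C *: x) z = - complex.Im (hdot x z).
Proof. by rewrite /rip linearZl_LR /=; case: (hdot x z) => a b /=; rewrite mul0r sub0r mul1r. Qed.

Lemma hdot_rip (x y x' y' : H) : rip x y = rip x' y' -> rip ('i%C *: x) y = rip ('i%C *: x') y' ->
  hdot x y = hdot x' y'.
Proof.
rewrite !ripil /rip => h1 /oppr_inj h2.
by apply/eqP; rewrite eq_complex h1 h2 !eqxx.
Qed.

Lemma ripDr x y z : rip z (x + y) = rip z x + rip z y.
Proof. by rewrite ![rip z _]ripC ripDl. Qed.
Lemma ripZr c x z : rip z (c%:C *: x) = c * rip z x.
Proof. by rewrite ![rip z _]ripC ripZl. Qed.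
Lemma ripNl x z : rip (- x) z = - rip x z.
Proof. by rewrite /rip linearNl raddfN. Qed.
Lemma ripNr x z : rip z (- x) = - rip z x.
Proof. by rewrite ![rip z _]ripC ripNl. Qed.
Lemma ripBl x y z : rip (x - y) z = rip x z - rip y z.
Proof. by rewrite ripDl ripNl. Qed.
Lemma ripBr x y z : rip z (x - y) = rip z x - rip z y.
Proof. by rewrite ripDr ripNr. Qed.
Lemma rip0l z : rip 0 z = 0.
Proof. by rewrite -[0 in LHS](subrr z) ripBl subrr. Qed.
Lemma rip0r z : rip z 0 = 0.
Proof. by rewrite ripC rip0l. Qed.

Definition ripE :=
  (ripDl, ripDr, ripBl, ripBr, ripNl, ripNr, ripZl, ripZr, rip0l, rip0r).

Lemma rip_ge0 x : 0 <= rip x x.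
Proof. by rewrite -nr_sqr sqr_ge0. Qed.

Lemma rip_eq0 x : rip x x = 0 -> x = 0.
Proof. by move=> h; apply: nr_eq0; apply/eqP; rewrite -sqrf_eq0 nr_sqr h. Qed.

Lemma nrB x y : nr (x - y) = nr (y - x).
Proof. by rewrite -nrN opprB. Qed.

(** Operators are compared weakly: most operator identities below are proved by
moving adjoints across [rip]. *)
Lemma rip_ext x y : (forall z, rip x z = rip y z) -> x = y.
Proof.
move=> h; apply/subr0_eq/rip_eq0.
by rewrite ripBl h subrr.
Qed.

Lemma le_nr x y : rip x x <= rip y y -> nr x <= nr y.
Proof. by move=> h; rewrite -ler_sqr ?nnegrE ?nr_ge0// !nr_sqr. Qed.

Lemma rip_le x y : rip x y <= nr x * nr y.
Proof.
have [y0|y0] := eqVneq (nr y) 0.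
  by rewrite y0 (nr_eq0 y0) rip0r mulr0.
have ygt0 : 0 < nr y by rewrite lt_def y0 nr_ge0.
have := rip_ge0 ((nr y)%:C *: x - (nr x)%:C *: y).
rewrite !ripE (ripC y x) -!nr_sqr => h.
have [x0|x0] := eqVneq (nr x) 0.
  by rewrite x0 (nr_eq0 x0) rip0l mul0r.
have xgt0 : 0 < nr x by rewrite lt_def x0 nr_ge0.
have : 0 < nr x * nr y by exact: mulr_gt0.
move=> p; rewrite -(ler_pM2l p); nra.
Qed.

Lemma rip_le_abs x y : `|rip x y| <= nr x * nr y.
Proof. by rewrite ler_norml rip_le andbT lerNl -ripNl -(nrN x) rip_le. Qed.

(** Convergence along a filter, with real epsilons; the filters needed are
that of the natural numbers and that of the tails of a chain of operators. *)
Definition tends {I : Type} (F : set_system I) (f : I -> H) (l : H) :=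
  forall e : R, 0 < e -> F [set i | nr (f i - l) < e].

Lemma gt0_realC (e : R[i]) : 0 < e -> exists2 d : R, 0 < d & e = d%:C.
Proof.
case: e => a b; rewrite ltcE /= => /andP[/eqP -> a0]; by exists a.
Qed.

Lemma tends_complete {I : Type} (F : set_system I) {FF : ProperFilter F} (f : I -> H) :
  (forall e : R, 0 < e -> exists2 A, F A & forall i j, A i -> A j -> nr (f i - f j) < e) ->
  exists l, tends F f l.
Proof.
move=> h.
have : cauchy (f @ F).
  apply/cauchy_exP => e /gt0_realC[d d0 ->].
  have [A FA hA] := h _ d0.
  have [i Ai] := filter_ex FA.
  exists (f i); rewrite /nbhs/=/fmap; apply: (filterS _ FA) => j Aj /=.
  rewrite /= -ball_normE /= nrE ltcR; exact: hA.
move/cauchy_cvg/cvg_ex => [l fl]; exists l => e e0.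
have e0' : (0 : R[i]) < e%:C by rewrite ltcR.
move/cvgrPdist_lt : fl => /(_ _ e0').
by apply: filterS => i /=; rewrite nrE ltcR nrB.
Qed.

Lemma tends_unique {I : Type} (F : set_system I) {FF : ProperFilter F} (f : I -> H) l l' :
  tends F f l -> tends F f l' -> l = l'.
Proof.
move=> h h'; apply/subr0_eq/nr_eq0/eqP/negP => /negP n0.
have e0 : 0 < nr (l - l') / 2 by rewrite divr_gt0// lt_def n0 nr_ge0.
have [i [/= a b]] := filter_ex (filterI (h _ e0) (h' _ e0)).
rewrite nrB in a.
have := nrD (l - f i) (f i - l').
rewrite addrA subrK; lra.
Qed.

Lemma bounded_opP (T : H -> H) : bounded_op T <->
  linear T /\ exists2 C : R, 0 <= C & forall x, nr (T x) <= C * nr x.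
Proof.
split=> [[linT cT]|[linT [C C0 hC]]]; split=> //.
- have T0 : T 0 = 0.
    by have := linT (-1) 0 0; rewrite scaler0 add0r scaleN1r addNr.
  have TZ a x : T (a *: x) = a *: T x by have := linT a x 0; rewrite !addr0 T0 addr0.
  have := cT 0; rewrite /continuous_at T0 => /cvgrPdist_lt /(_ 1 ltr01).
  case/nbhs_ballP => _ /gt0_realC[d d0 ->] hd.
  exists (2 / d); first by rewrite divr_ge0// ltW.
  move=> x; have [x0|x0] := eqVneq (nr x) 0.
    by rewrite (nr_eq0 x0) T0 nr0 mulr0.
  have xgt0 : 0 < nr x by rewrite lt_def x0 nr_ge0.
  have k0 : 0 < d / 2 / nr x by rewrite !divr_gt0.
  have := hd ((d / 2 / nr x)%:C *: x).
  rewrite -ball_normE /= !sub0r !normrN !nrE !ltcR TZ !nrZr !gtr0_norm//.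
  rewrite divfK// => /(_ _)/ltW; move/(_ ltac:(lra)) => h.
  have : (d / 2 / nr x) * (nr (T x)) <= (d / 2 / nr x) * (2 / d * nr x).
    suff -> : (d / 2 / nr x) * (2 / d * nr x) = 1 by [].
    by field; rewrite x0 gt_eqF.
  by rewrite ler_pM2l.
- move=> x; apply/cvgrPdist_lt => _ /gt0_realC[e e0 ->].
  apply/nbhs_ballP.
  have d0 : 0 < e / (C + 1) by rewrite divr_gt0//; lra.
  exists ((e / (C + 1))%:C); first by rewrite /= ltcR.
  move=> y; rewrite -ball_normE /= !nrE !ltcR => xy.
  have -> : T x - T y = T (x - y).
    by have := linT (-1) y x; rewrite !scaleN1r addrC => <-; rewrite addrC.
  apply: le_lt_trans (hC _) _.
  apply: (@le_lt_trans _ _ ((C + 1) * nr (x - y))).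
    by apply: ler_wpM2r; [exact: nr_ge0|lra].
  by rewrite mulrC -ltr_pdivlMr //; lra.
Qed.

End RealInner.

(** * Minimisation, adjoints and orthogonal projections *)

Section Riesz.
Context {R : realType} {H : hilbertType R}.
Implicit Types (x y z : H) (c : R).

Definition contains_limits (K : set H) : Prop :=
  forall l, (forall e : R, 0 < e -> exists2 k, K k & nr (k - l) < e) -> K l.

(** The quadratic functional J x = |x|^2 - 2 phi x is bounded below on K, and by
the parallelogram identity minimising sequences are Cauchy; the Euler equation
of the minimiser z is the claim.  The case of the whole space is Riesz'
theorem, and phi = rip ^~ y gives the orthogonal projection of y onto K. *)
Lemma riesz_on_closed_subspace (K : set H) (phi : H -> R) (C : R) :
  K 0 -> (forall x y, K x -> K y -> K (x + y)) ->
  (forall c x, K x -> K (c%:C *: x)) -> contains_limits K ->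
  (forall x y, phi (x + y) = phi x + phi y) ->
  (forall c x, phi (c%:C *: x) = c * phi x) ->
  (forall x, phi x <= C * nr x) ->
  exists2 z, K z & forall k, K k -> rip k z = phi k.
Proof.
move=> K0 KD KZ Kcl phiD phiZ phiC.
pose J x := rip x x - 2 * phi x.
pose E := [set J x | x in K].
have infE : has_inf E.
  split; first by exists (J 0), 0.
  exists (- C ^+ 2) => _ [x Kx <-]; rewrite /J -nr_sqr.
  have := phiC x; have := sqr_ge0 (nr x - C); nra.
have lbE x : K x -> inf E <= J x.
  by move=> Kx; apply: ge_inf; [case: infE | exists x].
have /choice[f fP] : forall n : nat, exists x, K x /\ J x < inf E + n.+1%:R^-1.
  move=> n; have n0 : (0 : R) < n.+1%:R^-1 by rewrite invr_gt0 ltr0n.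
  have [_ [x Kx <-] h] := inf_adherent n0 infE.
  by exists x.
(* Parallelogram identity, with J bounded below by inf E at the midpoint. *)
have par x y : K x -> K y -> rip (x - y) (x - y) <= 2 * (J x + J y) - 4 * inf E.
  move=> Kx Ky; have := lbE _ (KZ 2^-1 _ (KD _ _ Kx Ky)).
  rewrite /J !ripE phiZ phiD (ripC y x) !mulrA; lra.
have small (e : R) : 0 < e -> \forall n \near \oo, J (f n) < inf E + e.
  move=> e0; have := near_infty_natSinv_lt (PosNum e0).
  by apply: filterS => n /= ne; have [_ h] := fP n; apply: lt_trans h _; rewrite ltrD2l.
have [z fz] : exists z, tends \oo f z.
  apply: tends_complete => e e0.
  have d0 : 0 < e ^+ 2 / 4 by rewrite divr_gt0// exprn_gt0.
  exists [set n | J (f n) < inf E + e ^+ 2 / 4]; first exact: small.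
  move=> i j /= hi hj.
  rewrite -ltr_sqr ?nnegrE ?nr_ge0 ?ltW// nr_sqr.
  apply: le_lt_trans (par _ _ (fP i).1 (fP j).1) _; lra.
exists z.
  apply: Kcl => e /fz /filter_ex[n /= fn]; exists (f n) => //.
  exact: (fP n).1.
move=> k Kk; pose a := rip k z - phi k.
(* This is J (z + t k) >= J z, read off from J (f n + t k) >= inf E with f n near z. *)
have key t : 0 <= 2 * t * a + t ^+ 2 * rip k k.
  rewrite leNgt; apply/negP => neg.
  pose g := - (2 * t * a + t ^+ 2 * rip k k).
  have g0 : 0 < g by rewrite oppr_gt0.
  have p0 : 0 < 4 * (`|t| * nr k) + 1.
    by rewrite ltr_wpDl// !mulr_ge0// nr_ge0.
  have g4 : 0 < g / 2 by rewrite divr_gt0.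
  have gp : 0 < g / (4 * (`|t| * nr k) + 1) by rewrite divr_gt0.
  have [n [/= h1 h2]] := filter_ex (filterI (small _ g4) (fz _ gp)).
  have := lbE _ (KD _ _ (fP n).1 (KZ t _ Kk)).
  rewrite /J !ripE phiD phiZ (ripC k (f n)) => h3.
  have : 2 * t * (rip (f n) k - rip z k) <= g / 2.
    have h : t * rip (f n - z) k <= `|t| * nr k * nr (f n - z).
      apply: le_trans (ler_norm _) _; rewrite normrM -mulrA ler_wpM2l// mulrC.
      exact: rip_le_abs.
    rewrite ripBl in h.
    move: h2; rewrite ltr_pdivlMr// => h2.
    have := nr_ge0 (f n - z). lra.
  move: g0 h1 h3; rewrite /g /a (ripC k z) /J; lra.
(* This t makes the quadratic expression negative unless a = 0. *)
have := key (- a / (rip k k + 1)).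
have N0 := rip_ge0 k.
have N1 : 0 < rip k k + 1 by lra.
move=> h; suff : a = 0 by move/subr0_eq.
have e : 2 * (- a / (rip k k + 1)) * a + (- a / (rip k k + 1)) ^+ 2 * rip k k
  = - (a ^+ 2 * (rip k k + 2) / (rip k k + 1) ^+ 2).
  by field; rewrite gt_eqF.
rewrite e oppr_ge0 in h.
have : a ^+ 2 * (rip k k + 2) <= 0.
  by move: h; rewrite ler_pdivrMr ?mul0r// exprn_gt0.
move=> h'; apply/eqP; rewrite -sqrf_eq0 eq_le sqr_ge0 andbT; nra.
Qed.

(** With 'i for a, this recovers complex linearity from [rip] alone. *)
Lemma ripZJ (a : R[i]) x y : rip x (a *: y) = rip (a^*%C *: x) y.
Proof.
rewrite /rip linearZl_LR linearZr_LR /=.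
by case: a => a b; case: (hdot x y) => u v.
Qed.

Lemma opD T (bT : bounded_op T) x y : T (x + y : H) = T x + T y :> H.
Proof. by case: bT => l _; have := l 1 x y; rewrite !scale1r. Qed.
Lemma op0 T (bT : bounded_op T) : T (0 : H) = 0 :> H.
Proof. by case: bT => l _; have := l (-1) 0 0; rewrite scaler0 add0r scaleN1r addNr. Qed.
Lemma opZ T (bT : bounded_op T) a x : T (a *: x : H) = a *: T x :> H.
Proof. by case: (bT) => l _; have := l a x 0; rewrite !addr0 (op0 bT) addr0. Qed.
Lemma opN T (bT : bounded_op T) x : T (- x : H) = - T x :> H.
Proof. by rewrite -scaleN1r (opZ bT) scaleN1r. Qed.
Lemma opB T (bT : bounded_op T) x y : T (x - y : H) = T x - T y :> H.
Proof. by rewrite (opD bT) (opN bT). Qed.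

Lemma bounded_bound T : bounded_op T ->
  exists2 C : R, 0 < C & forall x : H, nr (T x : H) <= C * nr x.
Proof.
move=> /bounded_opP[_ [C C0 h]]; exists (C + 1); first lra.
by move=> x; apply: le_trans (h x) _; apply: ler_wpM2r; [exact: nr_ge0|lra].
Qed.

Lemma bounded_comp S T : bounded_op S -> bounded_op T -> bounded_op (S \o T : H -> H).
Proof.
move=> bS bT; have [C C0 hC] := bounded_bound bS; have [D D0 hD] := bounded_bound bT.
apply/bounded_opP; split.
  by move=> a x y /=; rewrite (opD bT) (opZ bT) (opD bS) (opZ bS).
exists (C * D); first by rewrite mulr_ge0// ltW.
move=> x; apply: le_trans (hC _) _; rewrite -mulrA; apply: ler_wpM2l => //; exact: ltW.
Qed.

Lemma bounded_add S T : bounded_op S -> bounded_op T -> bounded_op (fun x : H => S x + T x : H).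
Proof.
move=> bS bT; have [C C0 hC] := bounded_bound bS; have [D D0 hD] := bounded_bound bT.
apply/bounded_opP; split.
  by move=> a x y /=; rewrite (opD bT) (opZ bT) (opD bS) (opZ bS) scalerDr addrACA.
exists (C + D); first by rewrite addr_ge0// ltW.
by move=> x; apply: le_trans (nrD _ _) _; rewrite mulrDl lerD.
Qed.

Lemma bounded_scale a T : bounded_op T -> bounded_op (fun x : H => a *: T x : H).
Proof.
move=> bT; have [C C0 hC] := bounded_bound bT.
apply/bounded_opP; split.
  by move=> b x y /=; rewrite (opD bT) (opZ bT) scalerDr !scalerA mulrC.
have a0 : 0 <= complex.Re `|a| by rewrite -ler0c RRe_real ?normr_real.
exists (complex.Re `|a| * C); first by rewrite mulr_ge0// ltW.
by move=> x; rewrite nrZ -mulrA ler_wpM2l.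
Qed.

Lemma bounded_id : bounded_op (idfun : H -> H).
Proof.
apply/bounded_opP; split; first by [].
by exists 1 => // x; rewrite mul1r.
Qed.

Lemma adj_exists T : bounded_op T -> exists U, is_adjoint T (U : H -> H).
Proof.
move=> bT; have [C C0 hC] := bounded_bound bT.
have /choice[U hU] : forall y, exists z, forall x, rip x z = rip (T x) y.
  move=> y.
  have [|||||||z _ h] := @riesz_on_closed_subspace setT (fun x => rip (T x) y) (C * nr y) => //.
  - by move=> a b; rewrite (opD bT) ripDl.
  - by move=> c a; rewrite (opZ bT) ripZl.
  - move=> x; apply: le_trans (rip_le _ _) _.
    by rewrite [leRHS]mulrAC ler_wpM2r// nr_ge0.
  by exists z => x; exact: h.
exists U.
have bU : bounded_op U.
  apply/bounded_opP; split.
    move=> a x y; apply: rip_ext => z; rewrite ripDl ![rip _ z]ripC.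
    by rewrite ripZJ !hU ripDr ripZJ (opZ bT).
  exists C; first exact: ltW.
  move=> x; have := rip_le (T (U x)) x; rewrite -hU -nr_sqr.
  have [u0|u0] := eqVneq (nr (U x)) 0.
    by rewrite u0 mulr_ge0// ?nr_ge0// ltW.
  have ugt0 : 0 < nr (U x) by rewrite lt_def u0 nr_ge0.
  move=> h; rewrite -(ler_pM2l ugt0) -expr2; apply: le_trans h _.
  by rewrite mulrA [_ * C]mulrC; apply: ler_wpM2r; rewrite ?nr_ge0.
split=> // x y; apply: hdot_rip; rewrite hU //.
by rewrite (opZ bT).
Qed.

Lemma adjP T : bounded_op T -> is_adjoint T (adj T : H -> H).
Proof. by move=> /adj_exists[U hU]; have h := @xgetPex _ (idfun : H -> H) [set V | is_adjoint T V] (ex_intro _ U hU). Qed.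

Lemma bounded_adj T : bounded_op T -> bounded_op (adj T : H -> H).
Proof. by move/adjP => []. Qed.

Lemma ripA T x y : bounded_op T -> rip (T x) (y : H) = rip x (adj T y).
Proof. by move/adjP => [_ h]; rewrite /rip h. Qed.
Lemma ripA' T x y : bounded_op T -> rip (adj T x) (y : H) = rip x (T y).
Proof. by move=> bT; rewrite ripC -ripA// ripC. Qed.

Lemma adj_uniq T U : bounded_op T -> bounded_op U ->
  (forall x y : H, rip (T x) y = rip x (U y)) -> adj T = U.
Proof.
move=> bT bU h; apply/funext => y; apply: rip_ext => z.
by rewrite ripA'// ripC h ripC.
Qed.

Lemma adjK T : bounded_op T -> adj (adj T) = T :> (H -> H).
Proof. by move=> bT; apply: adj_uniq => //; [exact: bounded_adj|move=> x y; exact: ripA']. Qed.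

Lemma adj_comp S T : bounded_op S -> bounded_op T ->
  adj (S \o T) = adj T \o adj S :> (H -> H).
Proof.
move=> bS bT; apply: adj_uniq; [exact: bounded_comp|apply: bounded_comp; exact: bounded_adj|].
by move=> x y /=; rewrite !ripA.
Qed.

Lemma adj_add S T : bounded_op S -> bounded_op T ->
  adj (fun x => S x + T x) = (fun x => adj S x + adj T x) :> (H -> H).
Proof.
move=> bS bT; apply: adj_uniq; [exact: bounded_add|apply: bounded_add; exact: bounded_adj|].
by move=> x y /=; rewrite ripDl ripDr !ripA.
Qed.

Lemma adj_scale a T : bounded_op T ->
  adj (fun x => a *: T x) = (fun x => a^*%C *: adj T x) :> (H -> H).
Proof.
move=> bT; apply: adj_uniq; [exact: bounded_scale|apply: bounded_scale; exact: bounded_adj|].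
by move=> x y /=; rewrite ripC ripZJ -ripA' // (opZ (bounded_adj bT)) ripC.
Qed.

Lemma adj_id : adj idfun = idfun :> (H -> H).
Proof. by apply: adj_uniq => //; exact: bounded_id. Qed.

(** Closed complex subspaces are ranges of self-adjoint idempotents: q x is the
Riesz representative in K of the functional rip ^~ x. *)
Lemma projection_exists (K : set H) : K 0 -> (forall x y, K x -> K y -> K (x + y)) ->
  (forall (a : R[i]) x, K x -> K (a *: x)) -> contains_limits K ->
  exists q, [/\ bounded_op q, adj q = q, forall x, K (q x) & forall k, K k -> q k = k].
Proof.
move=> K0 KD KZ Kcl.
have /choice[q hq] : forall x, exists z, K z /\ forall k, K k -> rip k z = rip k x.
  move=> x; have [|||||||z Kz h] := @riesz_on_closed_subspace K (fun k => rip k x) (nr x) => //.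
  - by move=> c y; exact: KZ.
  - by move=> a b; rewrite ripDl.
  - by move=> c a; rewrite ripZl.
  - by move=> y; rewrite mulrC rip_le.
  by exists z.
have uq x z : K z -> (forall k, K k -> rip k z = rip k x) -> q x = z.
  move=> Kz h; apply/subr0_eq/rip_eq0.
  have Kd : K (q x - z) by apply: KD; [exact: (hq x).1|rewrite -scaleN1r; exact: KZ].
  by rewrite ripBr h// (hq x).2// subrr.
have bq : bounded_op q.
  apply/bounded_opP; split.
    move=> a x y; apply: uq; first by apply: KD; [apply: KZ; exact: (hq x).1|exact: (hq y).1].
    move=> k Kk; rewrite !ripDr !ripZJ (hq y).2// (hq x).2//; exact: KZ.
  exists 1 => // x; rewrite mul1r.
  have := rip_le (q x) x; rewrite -(hq x).2 -?nr_sqr; last exact: (hq x).1.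
  have := nr_ge0 (q x); have := nr_ge0 x; nra.
have sa : adj q = q.
  apply: adj_uniq => // x y.
  by rewrite -((hq y).2 _ (hq x).1) ripC ((hq x).2 _ (hq y).1) ripC.
exists q; split=> //; first by move=> x; exact: (hq x).1.
by move=> k Kk; exact: uq.
Qed.

End Riesz.

(** * Strong limits of operators *)

Section Limits.
Context {R : realType} {H : hilbertType R}.
Implicit Types (x y z : H) (c : R) (S T U V : H -> H).

Definition contractive T := bounded_op T /\ forall x, nr (T x) <= nr x.

Lemma contractive_adj T : contractive T -> contractive (adj T).
Proof.
move=> [bT cT]; split; first exact: bounded_adj.
move=> x; have := rip_le (T (adj T x)) x; rewrite ripA// -nr_sqr => h.
have := cT (adj T x); have := nr_ge0 x; have := nr_ge0 (adj T x); nra.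
Qed.

Section Filter.
Context {I : Type} (F : set_system I) {FF : ProperFilter F}.

Lemma tendsD (f g : I -> H) l m : tends F f l -> tends F g m ->
  tends F (fun i => f i + g i) (l + m).
Proof.
move=> fl gm e e0; have e2 : 0 < e / 2 by rewrite divr_gt0.
apply: filterS (filterI (fl _ e2) (gm _ e2)) => i /= [h1 h2].
rewrite opprD addrACA; apply: le_lt_trans (nrD _ _) _; lra.
Qed.

Lemma tends_op S (f : I -> H) l : bounded_op S -> tends F f l ->
  tends F (fun i => S (f i)) (S l).
Proof.
move=> bS fl e e0; have [C C0 hC] := bounded_bound bS.
apply: filterS (fl _ (divr_gt0 e0 C0)) => i /= h.
rewrite -(opB bS); apply: le_lt_trans (hC _) _.
by rewrite mulrC -ltr_pdivlMr.
Qed.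

Lemma tends_cst (l : H) : tends F (fun=> l) l.
Proof. by move=> e e0; rewrite subrr nr0; apply: filterS filterT. Qed.

Lemma tends_le (f : I -> H) l c : tends F f l -> F [set i | nr (f i) <= c] -> nr l <= c.
Proof.
move=> fl h; rewrite leNgt; apply/negP => cl.
have e0 : 0 < nr l - c by rewrite subr_gt0.
have [i [/= h1 h2]] := filter_ex (filterI (fl _ e0) h).
have := nrD (f i) (l - f i); rewrite addrC subrK nrB; lra.
Qed.

Lemma tends_ge (f : I -> H) l c : tends F f l -> F [set i | c <= nr (f i)] -> c <= nr l.
Proof.
move=> fl h; rewrite leNgt; apply/negP => cl.
have e0 : 0 < c - nr l by rewrite subr_gt0.
have [i [/= h1 h2]] := filter_ex (filterI (fl _ e0) h).
have := nrD (f i - l) l; rewrite subrK; lra.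
Qed.

Lemma tends_eq (f g : I -> H) l : F [set i | f i = g i] -> tends F f l -> tends F g l.
Proof. by move=> fg fl e e0; apply: filterS (filterI fg (fl e e0)) => i /= [<-]. Qed.

(** Convergence in the strong operator topology. *)
Definition sot (T : I -> H -> H) L := forall x, tends F (T ^~ x) (L x).

Lemma sot_contractive (T : I -> H -> H) L :
  (forall i, contractive (T i)) -> sot T L -> contractive L.
Proof.
move=> cT TL.
have h x : nr (L x) <= nr x.
  by apply: (tends_le (TL x)); apply: filterS filterT => i _; apply: (cT i).2.
split=> //; apply/bounded_opP; split; last by exists 1 => // x; rewrite mul1r.
move=> a x y; apply: (tends_unique (TL _)).
have h1 := tendsD (tends_op (bounded_scale a bounded_id) (TL x)) (TL y).
apply: tends_eq h1; apply: filterS filterT => i _ /=.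
by rewrite (opD (cT i).1) (opZ (cT i).1).
Qed.

(** Multiplication is jointly continuous for the strong topology on bounded
sets. *)
Lemma sot_comp (S T : I -> H -> H) S' T' : (forall i, contractive (S i)) ->
  sot S S' -> sot T T' -> sot (fun i => S i \o T i) (S' \o T').
Proof.
move=> cS SS TT x e e0 /=; have e2 : 0 < e / 2 by rewrite divr_gt0.
apply: filterS (filterI (SS (T' x) _ e2) (TT x _ e2)) => i /= [h1 h2].
have -> : S i (T i x) - S' (T' x) = S i (T i x - T' x) + (S i (T' x) - S' (T' x)).
  by rewrite (opB (cS i).1) addrA subrK.
apply: le_lt_trans (nrD _ _) _; have := (cS i).2 (T i x - T' x); lra.
Qed.

Lemma sot_compl S (T : I -> H -> H) L : bounded_op S -> sot T L ->
  sot (fun i => S \o T i) (S \o L).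
Proof. by move=> bS TL x; exact: tends_op. Qed.

Lemma sot_compr S (T : I -> H -> H) L : sot T L -> sot (fun i => T i \o S) (L \o S).
Proof. by move=> TL x; exact: TL. Qed.

Lemma sot_eq (S T : I -> H -> H) L : (forall i, S i = T i) -> sot S L -> sot T L.
Proof. by move=> h; have -> : S = T by apply/funext. Qed.

(** The adjoint is not strongly continuous: the strong convergence of the
adjoints has to be known separately. *)
Lemma sot_adj (T : I -> H -> H) L L' : (forall i, bounded_op (T i)) ->
  bounded_op L -> bounded_op L' -> sot T L -> sot (fun i => adj (T i)) L' -> adj L = L'.
Proof.
move=> bT bL bL' TL TL'; apply: adj_uniq => // x y.
apply/subr0_eq/eqP; rewrite -normr_le0 leNgt; apply/negP => d0.
set d := `|_| in d0.
have p0 : 0 < nr x + nr y + 1.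
  by have := nr_ge0 x; have := nr_ge0 y; lra.
have [i [/= h1 h2]] := filter_ex (filterI (TL x _ (divr_gt0 d0 p0)) (TL' y _ (divr_gt0 d0 p0))).
have : d <= nr (T i x - L x) * nr y + nr x * nr (adj (T i) y - L' y).
  have -> : d = `| - rip (T i x - L x) y + rip x (adj (T i) y - L' y)|.
    by rewrite /d !ripE (ripA _ _ (bT i)); congr `|_|; lra.
  apply: le_trans (ler_normD _ _) _; rewrite normrN.
  by apply: lerD; exact: rip_le_abs.
move: h1 h2; rewrite !ltr_pdivlMr//.
have := nr_ge0 x; have := nr_ge0 y.
have := nr_ge0 (T i x - L x); have := nr_ge0 (adj (T i) y - L' y).
nra.
Qed.

End Filter.
End Limits.

(** * Closure properties of von Neumann algebras *)

Section VonNeumann.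
Context {R : realType} {H : hilbertType R}.
Implicit Types (x y z : H) (c : R) (S T U V : H -> H).
Variable M : set (H -> H).
Hypothesis vM : von_neumann_algebra M.

Lemma vN_bounded T : M T -> bounded_op T.
Proof. by case: vM => h _ _; exact: h. Qed.

Lemma vN_bicommutant T : bounded_op T ->
  (forall U, commutant M U -> forall x, T (U x) = U (T x)) -> M T.
Proof.
move=> bT h; case: vM => _ _ <-; split=> // U MU.
by apply/funext => x /=; exact: h.
Qed.

Lemma commutantE U T x : commutant M U -> M T -> U (T x) = T (U x).
Proof. by move=> [_ h] /h /(congr1 (fun f => f x)). Qed.

Lemma vN_id : M idfun.
Proof. by apply: vN_bicommutant; first exact: bounded_id. Qed.

Lemma vN_comp S T : M S -> M T -> M (S \o T).
Proof.
move=> MS MT; apply: vN_bicommutant; first by apply: bounded_comp; exact: vN_bounded.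
by move=> U cU x /=; rewrite (commutantE _ cU MS) (commutantE _ cU MT).
Qed.

Lemma vN_add S T : M S -> M T -> M (fun x => S x + T x).
Proof.
move=> MS MT; apply: vN_bicommutant; first by apply: bounded_add; exact: vN_bounded.
by move=> U cU x /=; rewrite (opD cU.1) (commutantE _ cU MS) (commutantE _ cU MT).
Qed.

Lemma vN_scale a T : M T -> M (fun x => a *: T x).
Proof.
move=> MT; apply: vN_bicommutant; first by apply: bounded_scale; exact: vN_bounded.
by move=> U cU x /=; rewrite (opZ cU.1) (commutantE _ cU MT).
Qed.

Lemma vN_sub S T : M S -> M T -> M (fun x => S x - T x).
Proof.
move=> MS MT; have := vN_add MS (vN_scale (-1) MT).
by congr M; apply/funext => x; rewrite scaleN1r.
Qed.

Lemma vN_adj T : M T -> M (adj T).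
Proof. by case: vM => _ h _; exact: h. Qed.

Lemma commutant_adj T : commutant M T -> commutant M (adj T).
Proof.
move=> cT; have bT := cT.1; split; first exact: bounded_adj.
move=> U MU; apply/funext => x /=; apply: rip_ext => z.
have bU := vN_bounded MU.
by rewrite (ripA' _ _ bT) !(ripA _ _ bU) (ripA' _ _ bT) (commutantE _ cT (vN_adj MU)).
Qed.

(** A strong limit commutes with whatever its terms commute with. *)
Lemma vN_sot I (F : set_system I) {FF : ProperFilter F} (T : I -> H -> H) L :
  (forall i, M (T i)) -> sot F T L -> bounded_op L -> M L.
Proof.
move=> MT TL bL; apply: vN_bicommutant => // U cU x.
apply: (tends_unique (TL _)).
apply: (tends_eq _ (tends_op cU.1 (TL x))).
by apply: filterS filterT => i _ /=; rewrite (commutantE _ cU (MT i)).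
Qed.

End VonNeumann.

(** * Convergence of monotone families *)

Section Monotone.
Context {R : realType} {H : hilbertType R}.

(** If |f j - f i|^2 <= |f j|^2 - |f i|^2 along an order, then f is Cauchy as soon as
the norms are bounded.  This one principle yields the limit of the
Newton-Schulz iterates and that of a chain of partial isometries. *)
Lemma monotone_tends I (F : set_system I) {FF : ProperFilter F} (leI : I -> I -> Prop)
    (f : I -> H) (c : R) :
  (forall i, F [set j | leI i j]) -> (forall i j, leI i j \/ leI j i) ->
  (forall i j, leI i j -> rip (f j - f i) (f j - f i) <= rip (f j) (f j) - rip (f i) (f i)) ->
  (forall i, rip (f i) (f i) <= c) -> exists l, tends F f l.
Proof.
move=> Fle tot mono bnd; apply: tends_complete => e e0.
pose E := [set rip (f i) (f i) | i in setT].
have supE : has_sup E.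
  split; last by exists c => _ [i _ <-].
  by have [i _] := filter_ex (@filterT _ F _); exists (rip (f i) (f i)), i.
have e2 : 0 < e ^+ 2 by rewrite exprn_gt0.
have [_ [k _ <-] hk] := sup_adherent e2 supE.
exists [set j | leI k j]; first exact: Fle.
have ub i : rip (f i) (f i) <= sup E by apply: sup_upper_bound => //; exists i.
have lb i : leI k i -> sup E - e ^+ 2 < rip (f i) (f i).
  move=> /mono h; have := rip_ge0 (f i - f k); lra.
have key i j : leI i j -> leI k i -> nr (f j - f i) < e.
  move=> ij ki; rewrite -ltr_sqr ?nnegrE ?nr_ge0 ?ltW// nr_sqr.
  have := mono _ _ ij; have := ub j; have := lb _ ki; lra.
move=> i j /= ki kj; have [ij|ji] := tot i j; last exact: key.
by rewrite nrB; exact: key.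
Qed.

Lemma tends_shift (f : nat -> H) l : tends \oo f l -> tends \oo (fun n => f n.+1) l.
Proof.
move=> fl e /fl [N _ hN]; exists N => // n /= Nn.
by apply: hN => /=; exact: leqW.
Qed.

End Monotone.

(** * The Newton-Schulz iteration and polar decomposition *)

Section Polar.
Context {R : realType} {H : hilbertType R}.
Implicit Types (x y z : H) (c : R) (S T U V X d v : H -> H).

Definition defect X y : H := y - adj X (X y).
(** One step X (3 - X† X) / 2, written as X (1 + D / 2) with D = 1 - X† X. *)
Definition newton_schulz X y : H := X (y + 2^-1%:C *: defect X y).

Section Step.
Variable X : H -> H.
Hypothesis cX : contractive X.
Let bX := cX.1.
Let bA := bounded_adj bX.

Lemma bounded_defect : bounded_op (defect X).
Proof.
have := bounded_add bounded_id (bounded_scale (-1) (bounded_comp bA bX)).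
by congr bounded_op; apply/funext => y /=; rewrite scaleN1r.
Qed.

Lemma defect_sym y z : rip (defect X y) z = rip y (defect X z).
Proof. by rewrite !ripE (ripA' _ _ bX) (ripA _ _ bX). Qed.

Lemma defect_rip y : rip (defect X y) y = rip y y - rip (X y) (X y).
Proof. by rewrite !ripE (ripA' _ _ bX). Qed.

Lemma defect_ge0 y : 0 <= rip (defect X y) y.
Proof.
by rewrite defect_rip subr_ge0 -!nr_sqr ler_sqr ?nnegrE ?nr_ge0//; exact: cX.2.
Qed.

Lemma newton_schulzE y : newton_schulz X y = X y + 2^-1%:C *: (X y - X (adj X (X y))).
Proof. by rewrite /newton_schulz (opD bX) (opZ bX) (opB bX). Qed.

Lemma bounded_newton_schulz : bounded_op (newton_schulz X).
Proof.
exact: (bounded_comp bX (bounded_add bounded_id (bounded_scale _ bounded_defect))).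
Qed.

(** The recursion D' = (3 D^2 + D^3) / 4 has nonnegative coefficients only; all the
monotonicity below rests on this. *)
Lemma defect_newton_schulz y : defect (newton_schulz X) y =
  (3 / 4)%:C *: defect X (defect X y) + 4^-1%:C *: defect X (defect X (defect X y)).
Proof.
apply: rip_ext => z.
have -> : rip (defect (newton_schulz X) y) z = rip y z - rip (newton_schulz X y) (newton_schulz X z).
  by rewrite !ripE (ripA' _ _ bounded_newton_schulz).
have key u w : rip (X u) (X w) = rip (u - defect X u) w.
  by rewrite !ripE (ripA' _ _ bX); lra.
rewrite {2}/newton_schulz key.
have bD := bounded_defect; have sD := defect_sym.
rewrite (opD bD) (opZ bD); set D := defect X; rewrite -/D in sD.
clearbody D; rewrite !ripE -!sD; by field.
Qed.

Lemma contractive_newton_schulz : contractive (newton_schulz X).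
Proof.
split; first exact: bounded_newton_schulz.
move=> y; apply: le_nr.
rewrite -subr_ge0.
have <- : rip (defect (newton_schulz X) y) y = rip y y - rip (newton_schulz X y) (newton_schulz X y).
  by rewrite !ripE (ripA' _ _ bounded_newton_schulz).
rewrite defect_newton_schulz ripDl !ripZl addr_ge0// mulr_ge0//.
- by rewrite defect_sym rip_ge0.
- by rewrite defect_sym defect_ge0.
Qed.

(** The step commutes with the adjoint since X (X† X) = (X X†) X.  Hence the
adjoints of the iterates converge strongly too. *)
Lemma adj_newton_schulz : adj (newton_schulz X) = newton_schulz (adj X).
Proof.
apply: adj_uniq; first exact: bounded_newton_schulz.
  apply: (bounded_comp bA); apply: (bounded_add bounded_id); apply: bounded_scale.
  have := bounded_add bounded_id (bounded_scale (-1) (bounded_comp bX bA)).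
  by congr bounded_op; apply/funext => y /=; rewrite /defect scaleN1r adjK.
move=> y z; rewrite newton_schulzE /newton_schulz -(ripA _ _ bX) /defect (adjK bX) !ripE.
by rewrite (ripA (adj X (X y)) z bX) (ripA' _ _ bX).
Qed.

End Step.

(** The polynomials in d with nonnegative coefficients. *)
Inductive pos_poly (d : H -> H) : (H -> H) -> Prop :=
| Pos_id : pos_poly d idfun
| Pos_mul T of pos_poly d T : pos_poly d (d \o T)
| Pos_add S T of pos_poly d S & pos_poly d T : pos_poly d (fun y => S y + T y)
| Pos_scale c T of 0 <= c & pos_poly d T : pos_poly d (fun y => c%:C *: T y).

Lemma pos_poly_comp d S T : pos_poly d S -> pos_poly d T -> pos_poly d (S \o T).
Proof.
move=> dS dT; elim: dS => //.
- by move=> U _ h; exact: (Pos_mul h).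
- by move=> U V _ hU _ hV; exact: (Pos_add hU hV).
- by move=> c U c0 _ h; exact: (Pos_scale c0 h).
Qed.

(** With D = 1 - X† X, the first inequality says X† X P(D) >= 0.  On a monomial D^k with
k even, X† X D^k is D^(k/2) (X† X) D^(k/2), and with k odd one is left with
X† X D = X† (1 - X X†) X >= 0.  The second inequality, for P(D) D, is there so
that the induction can step from the degree k to k + 1. *)
Lemma pos_poly_ge0 X P : contractive X -> pos_poly (defect X) P ->
  forall y, 0 <= rip (X (P y)) (X y) /\ 0 <= rip (X (P (defect X y))) (X y).
Proof.
move=> cX; have bD := bounded_defect cX.
have bX := cX.1.
have key u w : rip (X (defect X u)) (X w) = rip (X u) (X (defect X w)).
  rewrite !(ripA _ _ bX) (defect_sym cX).
  by rewrite /defect (opB bX) (opB (bounded_adj bX)).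
have comm Q y : pos_poly (defect X) Q -> Q (defect X y) = defect X (Q y).
  move=> hQ; elim: hQ y => //=.
  - by move=> T _ IH y; rewrite IH.
  - by move=> S T _ IS _ IT y; rewrite IS IT (opD bD).
  - by move=> c T _ _ IT y; rewrite IT (opZ bD).
elim.
- move=> y; split; first exact: rip_ge0.
  rewrite /= /defect (opB bX) ripBl -nr_sqr [X in _ - X]ripC.
  have cA := contractive_adj cX.
  rewrite subr_ge0; apply: le_trans (rip_le _ _) _; rewrite expr2 ler_wpM2l ?nr_ge0//.
  apply: le_trans (cX.2 _) _; exact: cA.2.
- move=> T hT IH y; split; first by rewrite /= -comm//; exact: (IH y).2.
  by rewrite /= key; exact: (IH (defect X y)).1.
- move=> S T hS IS hT IT y /=; rewrite !(opD bX) !ripDl.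
  by have [? ?] := IS y; have [? ?] := IT y; split; apply: addr_ge0.
- move=> c T c0 hT IT y /=; rewrite !(opZ bX) !ripZl.
  by have [? ?] := IT y; split; apply: mulr_ge0.
Qed.

End Polar.

Section PolarLimit.
Context {R : realType} {H : hilbertType R}.
Implicit Types (x y z : H) (c : R) (S T U V X d v : H -> H).

Definition ns_iter X k : H -> H := iter k newton_schulz X.

Lemma contractive_ns_iter X k : contractive X -> contractive (ns_iter X k).
Proof. by move=> cX; elim: k => //= k; exact: contractive_newton_schulz. Qed.

Lemma adj_ns_iter X k : contractive X -> adj (ns_iter X k) = ns_iter (adj X) k.
Proof.
move=> cX; elim: k => //= k IH.
by rewrite -IH adj_newton_schulz//; exact: contractive_ns_iter.
Qed.

Lemma ns_iterD X j k : ns_iter (ns_iter X k) j = ns_iter X (j + k).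
Proof. by rewrite /ns_iter iterD. Qed.

Lemma defect_ns_iter X j : contractive X -> pos_poly (defect X) (defect (ns_iter X j)).
Proof.
move=> cX; elim: j => [|j IH] /=; first by have := Pos_mul (Pos_id (defect X)).
have -> : defect (newton_schulz (ns_iter X j)) = fun y => (3 / 4)%:C *: defect (ns_iter X j) (defect (ns_iter X j) y) +
    4^-1%:C *: defect (ns_iter X j) (defect (ns_iter X j) (defect (ns_iter X j) y)).
  by apply/funext => y; rewrite defect_newton_schulz//; exact: contractive_ns_iter.
have h2 := pos_poly_comp IH IH; have h3 := pos_poly_comp IH h2.
by apply: Pos_add; [apply: Pos_scale h2|apply: Pos_scale h3].
Qed.

(** X_j = X (1 + P) with P a polynomial in 1 - X† X with nonnegative
coefficients, the product of the factors 1 + D_i / 2 for i < j being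
expanded, where D_i = 1 - X_i† X_i. *)
Lemma ns_iter_factor X j : contractive X ->
  exists2 P, pos_poly (defect X) P & forall y, ns_iter X j y = X (y + P y).
Proof.
move=> cX; elim: j => [|j [P hP IH]].
  exists (fun y => 0%:C *: y); first exact: (Pos_scale (lexx 0) (Pos_id _)).
  by move=> y; rewrite scale0r addr0.
have hD := Pos_scale (ltac:(by []) : 0 <= (2^-1 : R)) (defect_ns_iter j cX).
exists (fun y => 2^-1%:C *: defect (ns_iter X j) y + P (y + 2^-1%:C *: defect (ns_iter X j) y)).
  exact: (Pos_add hD (pos_poly_comp hP (Pos_add (Pos_id _) hD))).
by move=> y /=; rewrite {1}/newton_schulz IH addrA.
Qed.

(** The Pythagorean estimate demanded by [monotone_tends].  It amounts to
rip (X_k y) (X_j y) >= |X_j y|^2, which [pos_poly_ge0] provides after replacing X by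
X_j in [ns_iter_factor]. *)
Lemma ns_iter_mono X j k y : contractive X -> (j <= k)%N ->
  rip (ns_iter X k y - ns_iter X j y) (ns_iter X k y - ns_iter X j y)
    <= rip (ns_iter X k y) (ns_iter X k y) - rip (ns_iter X j y) (ns_iter X j y).
Proof.
move=> cX /subnK <-; rewrite -ns_iterD; have := contractive_ns_iter j cX.
move: (ns_iter X j) (k - j)%N => Y m cY.
have [P hP e] := ns_iter_factor m cY.
suff : rip (Y y) (Y y) <= rip (ns_iter Y m y) (Y y).
  by rewrite !ripE (ripC (Y y)); lra.
rewrite e (opD cY.1) ripDl lerDl.
by have [] := pos_poly_ge0 cY hP y.
Qed.

Lemma ns_iter_cvg X : contractive X -> exists v, sot \oo (ns_iter X) v.
Proof.
move=> cX; suff /choice[v hv] : forall y, exists l, tends \oo (ns_iter X ^~ y) l by exists v.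
move=> y; apply: (@monotone_tends _ _ _ _ _ leq _ (rip y y)).
- by move=> i; exists i.
- by move=> i j; apply/orP; exact: leq_total.
- by move=> i j ij; exact: ns_iter_mono.
- move=> i; rewrite -!nr_sqr ler_sqr ?nnegrE ?nr_ge0//.
  exact: (contractive_ns_iter i cX).2.
Qed.

(** The limit v satisfies the fixed point equation v = v (3 - v† v) / 2, so that
v v† v = v.  Since |X y| <= |X_k y|, the kernel of v is contained in that of X,
which gives X v† v = X. *)
Lemma ns_iter_limit X v : contractive X -> sot \oo (ns_iter X) v ->
  forall y, X (adj v (v y)) = X y /\ v (adj v (v y)) = v y.
Proof.
move=> cX Xv y.
have cn k := contractive_ns_iter k cX.
have cv : contractive v by apply: (sot_contractive cn Xv).
have [w Xw] := ns_iter_cvg (contractive_adj cX).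
have Xw' : sot \oo (fun k => adj (ns_iter X k)) w.
  by apply: sot_eq Xw => k; rewrite adj_ns_iter.
have cw : contractive w.
  by apply: (sot_contractive _ Xw) => k; apply: contractive_ns_iter; exact: contractive_adj.
have aw : adj v = w by apply: (sot_adj (fun k => (cn k).1) cv.1 cw.1 Xv Xw').
have vvv u : v (adj v (v u)) = v u.
  have h1 : tends \oo (fun k => ns_iter X k.+1 u) (v u) := tends_shift (Xv u).
  have h2 : tends \oo (fun k => ns_iter X k (adj (ns_iter X k) (ns_iter X k u))) (v (w (v u))).
    by apply: (sot_comp cn Xv (sot_comp (fun k => contractive_adj (cn k)) Xw' Xv)).
  have h3 : tends \oo (fun k => ns_iter X k.+1 u)
      (v u + 2^-1%:C *: (v u - v (w (v u)))).
    have h4 : tends \oo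
        (fun k => ns_iter X k u - ns_iter X k (adj (ns_iter X k) (ns_iter X k u))) (v u - v (w (v u))).
      suff h : tends \oo (fun k => - ns_iter X k (adj (ns_iter X k) (ns_iter X k u))) (- v (w (v u))).
        by apply: (tendsD (Xv u) h).
      rewrite -scaleN1r; apply: tends_eq (tends_op (bounded_scale (-1) bounded_id) h2).
      by apply: filterS filterT => k _ /=; rewrite scaleN1r.
    have h5 : tends \oo (fun k => ns_iter X k u + 2^-1%:C *:
        (ns_iter X k u - ns_iter X k (adj (ns_iter X k) (ns_iter X k u)))) (v u + 2^-1%:C *: (v u - v (w (v u)))).
      by apply: (tendsD (Xv u) (tends_op (bounded_scale (2^-1%:C) bounded_id) h4)).
    apply: tends_eq h5; apply: filterS filterT => k _ /=.
    by rewrite (newton_schulzE (cn k)).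
  have /eqP : v u = v u + 2^-1%:C *: (v u - v (w (v u))) by apply: (tends_unique h1 h3).
  rewrite -subr_eq0 opprD addrA subrr sub0r oppr_eq0 scaler_eq0 => /orP[|].
    by rewrite -(rmorph0 (real_complex R)) (inj_eq (@complexI _)) invr_eq0 pnatr_eq0.
  by rewrite subr_eq0 aw => /eqP.
split=> //.
suff : X (y - adj v (v y)) = 0 by rewrite (opB cX.1) => /subr0_eq.
apply/nr_eq0/eqP; rewrite eq_le nr_ge0 andbT.
rewrite -(@nr0 _ H); have -> : 0 = v (y - adj v (v y)) by rewrite (opB cv.1) vvv subrr.
apply: (tends_ge (Xv _)); apply: filterS filterT => k _ /=.
apply: le_nr; have := @ns_iter_mono X 0 k (y - adj v (v y)) cX (leq0n _).
have := rip_ge0 (ns_iter X k (y - adj v (v y)) - ns_iter X 0 (y - adj v (v y))).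
rewrite /ns_iter /=; lra.
Qed.

(** The polar part v of X.  The last identity is the one before it for X†, whose
iterates are the adjoints of those of X and converge to v†. *)
Lemma polar_decomposition X : contractive X -> exists v, [/\ contractive v,
  sot \oo (ns_iter X) v, sot \oo (ns_iter (adj X)) (adj v),
  (forall y, v (adj v (v y)) = v y) &
  (forall y, X (adj v (v y)) = X y) /\ (forall y, v (adj v (X y)) = X y)].
Proof.
move=> cX.
have cA := contractive_adj cX.
have cn k := contractive_ns_iter k cX.
have [v Xv] := ns_iter_cvg cX; have [w Xw] := ns_iter_cvg cA.
have cv : contractive v by apply: (sot_contractive cn Xv).
have cw : contractive w by apply: (sot_contractive (fun k => contractive_ns_iter k cA) Xw).
have aw : adj v = w.
  apply: (sot_adj (fun k => (cn k).1) cv.1 cw.1 Xv).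
  by apply: sot_eq Xw => k; rewrite adj_ns_iter.
exists v; rewrite aw; split=> //.
  by move=> y; rewrite -aw; exact: (ns_iter_limit cX Xv y).2.
split; first by move=> y; rewrite -aw; exact: (ns_iter_limit cX Xv y).1.
move=> y; apply: rip_ext => z.
have := (ns_iter_limit cA Xw z).1; rewrite -aw (adjK cv.1) => e.
by rewrite (ripA _ _ cv.1) (ripA' _ _ cv.1) !(ripA _ _ cX.1) e.
Qed.

End PolarLimit.

(** * A von Neumann algebra is generated by its unitaries *)

Section Cayley.
Context {R : realType} {H : hilbertType R}.
Implicit Types (x y z : H) (c : R) (S T U V X d v : H -> H).

Lemma conjc_i : ('i%C)^*%C = - 'i%C :> R[i].
Proof. by apply/eqP; rewrite eq_complex /= oppr0 !eqxx. Qed.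

(** The iterates are polynomials in X and X†. *)
Lemma ns_iter_commute S X k : contractive X -> bounded_op S ->
  (forall y, S (X y) = X (S y)) -> (forall y, S (adj X y) = adj X (S y)) ->
  (forall y, S (ns_iter X k y) = ns_iter X k (S y)) /\
  (forall y, S (ns_iter (adj X) k y) = ns_iter (adj X) k (S y)).
Proof.
move=> cX bS h h'; elim: k => [|k [IH IH']]; first by split.
have cY := contractive_ns_iter k cX; have cZ := contractive_ns_iter k (contractive_adj cX).
have e1 := adj_ns_iter k cX.
have e2 : adj (ns_iter (adj X) k) = ns_iter X k by rewrite -e1 (adjK cY.1).
by split=> y; rewrite /= -/(ns_iter _ _) !newton_schulzE// ?e1 ?e2 (opD bS) (opZ bS) (opB bS);
  rewrite !(IH, IH').
Qed.

(** In the limit this gives v X† = v† X for the polar part v of a normal X: both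
are the absolute value of X. *)
Lemma ns_iter_normal X k y : contractive X -> (forall y, X (adj X y) = adj X (X y)) ->
  ns_iter X k (adj X y) = ns_iter (adj X) k (X y).
Proof.
move=> cX nX; have cA := contractive_adj cX.
elim: k => [|k IH] /=; first exact: nX.
rewrite -!/(ns_iter _ _).
have cY := contractive_ns_iter k cX; have cZ := contractive_ns_iter k cA.
have e1 := adj_ns_iter k cX.
have e2 : adj (ns_iter (adj X) k) = ns_iter X k by rewrite -e1 (adjK cY.1).
have YX z : ns_iter X k (X z) = X (ns_iter X k z).
  by have [-> //] := @ns_iter_commute X X k cX cX.1 (fun=> erefl) nX.
have YA z : ns_iter X k (adj X z) = adj X (ns_iter X k z).
  by have [-> //] := @ns_iter_commute (adj X) X k cX cA.1 (fun z => esym (nX z)) (fun=> erefl).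
have YZ z : ns_iter X k (ns_iter (adj X) k z) = ns_iter (adj X) k (ns_iter X k z).
  by have [_ ->] := @ns_iter_commute (ns_iter X k) X k cX cY.1 YX YA.
by rewrite !newton_schulzE// e1 e2 IH YZ.
Qed.

Section Unitaries.
Variables (B : set (H -> H)) (T : H -> H).
Hypothesis vB : von_neumann_algebra B.
Hypothesis bT : bounded_op T.
Hypothesis TU : forall u, B u -> unitary u -> forall y, T (u y) = u (T y).

Lemma vN_defect X : B X -> B (defect X).
Proof.
move=> BX; apply: (vN_sub vB (vN_id vB)).
exact: (vN_comp vB (vN_adj vB BX) BX).
Qed.

Lemma vN_ns_iter X k : B X -> B (ns_iter X k).
Proof.
move=> BX; elim: k => //= k IH; apply: (vN_comp vB IH).
apply: (vN_add vB (vN_id vB)); apply: (vN_scale vB); exact: vN_defect.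
Qed.

(** The Cayley transform.  The polar part v of the normal operator
X = 1/2 + i a is a unitary of B with v^2 X† = X, so that v^2 = (1 + 2 i a) / (1 - 2 i a).
If T commutes with v, then D = T a - a T satisfies v^2 D = - D, and therefore
X D = v^2 X† D = - X† D, which says D = 0. *)
Lemma commute_selfadjoint a : B a -> adj a = a -> (forall y, nr (a y) <= 2^-1 * nr y) ->
  forall y, T (a y) = a (T y).
Proof.
move=> Ba sa ca.
have ba := vN_bounded vB Ba.
pose X y := 2^-1%:C *: y + 'i%C *: a y.
have BX : B X by apply: (vN_add vB); apply: (vN_scale vB) => //; exact: (vN_id vB).
have bX := vN_bounded vB BX.
have i_nr y : nr ('i%C *: y) = nr y.
  by rewrite nrZ normc_def /= expr0n expr1n add0r sqrtr1 mul1r.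
have cX : contractive X.
  split=> // y; apply: le_trans (nrD _ _) _; rewrite nrZr i_nr ger0_norm ?invr_ge0//.
  have := ca y; lra.
have aX : adj X = fun y => 2^-1%:C *: y - 'i%C *: a y.
  rewrite /X (adj_add (bounded_scale _ bounded_id) (bounded_scale _ ba)).
  rewrite (adj_scale _ bounded_id) (adj_scale _ ba) adj_id sa.
  apply/funext => y; congr (_ + _).
    by rewrite conjc_real.
  rewrite -scaleNr; by rewrite conjc_i.
have nX y : X (adj X y) = adj X (X y).
  rewrite aX /X !(opB ba) !(opD ba) !(opZ ba).
  rewrite !scalerBr !scalerDr !scalerA (mulrC 'i%C 2^-1%:C) addrA subrK.
  by rewrite opprD addrA addrK.
(* The operator i a is skew-adjoint. *)
have rip_ia y : rip ('i%C *: a y) y = 0.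
  have h1 : rip ('i%C *: a y) y = rip ('i%C *: y) (a y).
    by rewrite -(opZ ba) (ripA _ _ ba) sa.
  have h2 : rip ('i%C *: a y) y = - rip ('i%C *: y) (a y).
    by rewrite ripC ripZJ -ripNl -scaleNr conjc_i.
  lra.
have inj y : X y = 0 -> y = 0.
  move=> /(congr1 (rip^~ y)); rewrite /X ripDl rip_ia ripZl rip0l => h.
  by apply: rip_eq0; lra.
have injA y : adj X y = 0 -> y = 0.
  rewrite aX => /(congr1 (rip^~ y)); rewrite ripBl rip_ia ripZl rip0l => h.
  by apply: rip_eq0; lra.
have [v [cv Xv Av vvv [Xvv vvX]]] := polar_decomposition cX.
have Bv : B v.
  by apply: (vN_sot vB _ Xv cv.1) => k; exact: vN_ns_iter.
have bA := bounded_adj bX.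
have uv : unitary v.
  split; apply/funext => y /=; apply/subr0_eq.
    by apply: inj; rewrite (opB bX) Xvv subrr.
  apply: injA; rewrite (opB bA); apply/eqP; rewrite subr_eq0; apply/eqP.
  apply: rip_ext => z.
  by rewrite !(ripA' _ _ bX) (ripA _ _ cv.1) (ripA' _ _ cv.1) vvX.
have vXX y : v (v (adj X y)) = X y.
  rewrite -[RHS]vvX; congr v.
  have h : tends \oo (fun k => ns_iter (adj X) k (X y)) (v (adj X y)).
    apply: tends_eq (Xv _); apply: filterS filterT => k _ /=.
    exact: ns_iter_normal.
  by apply: (tends_unique h (Av _)).
have vA y : v (adj X y) = adj X (v y).
  have h : tends \oo (fun k => ns_iter X k (adj X y)) (adj X (v y)).
    apply: tends_eq (tends_op bA (Xv _)); apply: filterS filterT => k _ /=.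
    by have [-> //] := @ns_iter_commute (adj X) X k cX bA (fun z => esym (nX z)) (fun=> erefl).
  by apply: (tends_unique (Xv _) h).
move=> y.
pose D := T (a y) - a (T y).
(* The commutators of T with X and with X† are opposite. *)
have TXD : T (X y) - X (T y) = 'i%C *: D.
  by rewrite /X (opD bT) !(opZ bT) opprD addrACA subrr add0r -scalerBr.
have TAD : T (adj X y) - adj X (T y) = - ('i%C *: D).
  by rewrite aX (opB bT) !(opZ bT) opprD opprK addrACA subrr add0r scalerBr opprB addrC.
have vD : v (v D) = - D.
  have Tv z : T (v z) = v (T z) := TU Bv uv z.
  have h : v (v ('i%C *: D)) = 'i%C *: - D.
    have bv := cv.1.
    by rewrite scalerN -[X in v (v X)]opprK -TAD !(opN bv) !(opB bv) -!Tv !vXX TXD.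
  by apply: (scalerI (_ : 'i%C != 0)); rewrite ?neq0Ci// -!(opZ cv.1).
have : X D = - adj X D.
  by rewrite -vXX 2!vA vD (opN bA).
rewrite aX /X opprB addrC => /addrI /eqP.
rewrite -addr_eq0 -scalerDl scaler_eq0 => /orP[|/eqP/subr0_eq //].
rewrite -rmorphD -(rmorph0 (real_complex R)) (inj_eq (@complexI _)).
by rewrite gt_eqF.
Qed.

End Unitaries.
End Cayley.

Section Generation.
Context {R : realType} {H : hilbertType R}.
Implicit Types (x y z : H) (c : R) (S T U V X v b : H -> H).
Variable B : set (H -> H).
Hypothesis vB : von_neumann_algebra B.

Lemma scale_contractive T (r : R) : bounded_op T -> 0 < r ->
  exists2 k : R, 0 < k & forall y, nr (k%:C *: T y) <= r * nr y.
Proof.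
move=> bT r0; have [C C0 hC] := bounded_bound bT.
have k0 : 0 < r / C by rewrite divr_gt0.
exists (r / C) => // y; rewrite nrZr gtr0_norm//.
by rewrite -mulrA ler_wpM2l ?(ltW r0)// mulrC ler_pdivrMr// mulrC.
Qed.

Lemma realC_neq0 c : 0 < c -> c%:C != 0 :> R[i].
Proof. by move=> c0; rewrite -(rmorph0 (real_complex R)) (inj_eq (@complexI _)) gt_eqF. Qed.

(** The statement that the unitaries of B generate B, in the form used later.  It
reduces to the self-adjoint operators b + b† and i (b - b†), scaled down to
norm at most 1/2. *)
Lemma commute_unitaries T : bounded_op T ->
  (forall u, B u -> unitary u -> forall y, T (u y) = u (T y)) ->
  forall b, B b -> forall y, T (b y) = b (T y).
Proof.
move=> bT TU.
have sa a : B a -> adj a = a -> forall y, T (a y) = a (T y).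
  move=> Ba aa y; have ba := vN_bounded vB Ba.
  have [k k0 hk] := scale_contractive ba (ltac:(by []) : 0 < (2^-1 : R)).
  apply: (scalerI (realC_neq0 k0)); rewrite -(opZ bT).
  apply: (@commute_selfadjoint _ _ B T vB bT TU (fun y => k%:C *: a y)) => //.
    exact: vN_scale.
  by rewrite adj_scale// aa conjc_real.
move=> b Bb y; have bb := vN_bounded vB Bb; have Ab := vN_adj vB Bb.
have bA := vN_bounded vB Ab.
have h1 : T (b y + adj b y) = b (T y) + adj b (T y).
  apply: (sa (fun y => b y + adj b y)); first exact: (vN_add vB).
  by rewrite adj_add// adjK//; apply/funext => z; rewrite addrC.
have h2 : T (b y - adj b y) = b (T y) - adj b (T y).
  apply: (scalerI (_ : 'i%C != 0)); first by rewrite neq0Ci.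
  rewrite -(opZ bT).
  apply: (sa (fun y => 'i%C *: (b y - adj b y))).
    by apply: (vN_scale vB); exact: (vN_sub vB).
  apply: adj_uniq; try by apply: (vN_bounded vB); apply: (vN_scale vB); exact: (vN_sub vB).
  move=> u w; rewrite [RHS]ripZJ [LHS]ripC ripZJ conjc_i !scaleNr !ripNl.
  rewrite ripBr -(ripA' _ _ bb) -(ripA _ _ bb) -ripBl (opZ bA) (opZ bb) -scalerBr.
  by rewrite ripC ripZJ conjc_i scaleNr ripNl -ripNr opprB.
apply: (scalerI (realC_neq0 (ltac:(by []) : 0 < (2 : R)))).
have two u : 2%:C *: u = u + u :> H by rewrite (_ : 2%:C = 1 + 1) ?scalerDl ?scale1r// -rmorphD.
rewrite !two.
have -> : T (b y) + T (b y) = T (b y + adj b y) + T (b y - adj b y).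
  by rewrite (opD bT) (opB bT) addrACA subrr addr0.
by rewrite h1 h2 addrACA subrr addr0.
Qed.

End Generation.

(** * The polar part of a normaliser *)

Section NormaliserPolar.
Context {R : realType} {H : hilbertType R}.
Implicit Types (x y z : H) (c : R) (S T U V X v n b : H -> H).
Variables B M : set (H -> H).
Hypothesis vB : von_neumann_algebra B.
Hypothesis vM : von_neumann_algebra M.

(** While n need not be in B, it is followed in [ns_iter] by a
polynomial in n† n. *)
Lemma ns_iter_right_factor n k : contractive n -> B (adj n \o n) ->
  exists2 g, B g & ns_iter n k = n \o g.
Proof.
move=> cn Bh; elim: k => [|k [g Bg IH]]; first by exists idfun; [exact: vN_id|].
have bg := vN_bounded vB Bg.
exists (fun y => g (y + 2^-1%:C *: defect (n \o g) y)); last by rewrite /= -/(ns_iter _ _) IH.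
have := vN_comp vB Bg (vN_add vB (vN_id vB) (vN_scale vB (2^-1%:C) (_ : B (defect (n \o g))))).
apply.
have := vN_sub vB (vN_id vB) (vN_comp vB (vN_comp vB (vN_adj vB Bg) Bh) Bg).
by rewrite /defect (adj_comp cn.1 bg).
Qed.

(** With X_k = n g and g in B one has X_k b X_k† = n (g b g†) n† and
X_k† b X_k = g† (n† b n) g, which are in B, and X_k† n = g† (n† n).  Strong limits of
these stay in B. *)
Lemma normaliser_polar n v : contractive n -> normaliser M B n ->
  contractive v -> sot \oo (ns_iter n) v -> sot \oo (ns_iter (adj n)) (adj v) ->
  normaliser M B v /\ B (adj v \o n).
Proof.
move=> cn [Mn Nn] cv nv nv'.
have Bh : B (adj n \o n) by have [_] := Nn _ (vN_id vB).
have nv'' : sot \oo (fun k => adj (ns_iter n k)) (adj v).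
  by apply: sot_eq nv' => k; rewrite adj_ns_iter.
have ck k := contractive_ns_iter k cn.
have bA := (contractive_adj cv).1.
split; last first.
  have h : sot \oo (fun k => adj (ns_iter n k) \o n) (adj v \o n) by exact: sot_compr.
  apply: (vN_sot vB _ h); last exact: bounded_comp bA cn.1.
  move=> k; have [g Bg ->] := ns_iter_right_factor k cn Bh.
  by rewrite (adj_comp cn.1 (vN_bounded vB Bg)); exact: (vN_comp vB (vN_adj vB Bg) Bh).
split.
  by apply: (vN_sot vM _ nv cv.1) => k; exact: vN_ns_iter.
move=> b Bb; have bb := vN_bounded vB Bb; split.
- have h : sot \oo (fun k => ns_iter n k \o (b \o adj (ns_iter n k))) (v \o (b \o adj v)).
    by apply: (sot_comp ck nv (sot_compl bb nv'')).
  apply: (vN_sot vB _ h); last exact: bounded_comp cv.1 (bounded_comp bb bA).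
  move=> k; have [g Bg ->] := ns_iter_right_factor k cn Bh.
  rewrite (adj_comp cn.1 (vN_bounded vB Bg)).
  by have [] := Nn _ (vN_comp vB Bg (vN_comp vB Bb (vN_adj vB Bg))).
- have h : sot \oo (fun k => adj (ns_iter n k) \o (b \o ns_iter n k)) (adj v \o (b \o v)).
    by apply: (sot_comp (fun k => contractive_adj (ck k)) nv'' (sot_compl bb nv)).
  apply: (vN_sot vB _ h); last exact: bounded_comp bA (bounded_comp bb cv.1).
  move=> k; have [g Bg ->] := ns_iter_right_factor k cn Bh.
  rewrite (adj_comp cn.1 (vN_bounded vB Bg)).
  have [_ h'] := Nn _ Bb.
  exact: (vN_comp vB (vN_adj vB Bg) (vN_comp vB h' Bg)).
Qed.

End NormaliserPolar.

(** * Partial isometries between projections of a factor *)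

Section FactorLink.
Context {R : realType} {H : hilbertType R}.
Implicit Types (x y z : H) (r : R) (S T U V X v n b : H -> H).

(** Invariance of K under T and T† gives q T q = T q and q T† q = T† q; the
adjoint of the second is q T q = q T. *)
Lemma invariant_projection (K : set H) q T : bounded_op T -> bounded_op q -> adj q = q ->
  (forall x, K (q x)) -> (forall k, K k -> q k = k) ->
  (forall x, K x -> K (T x)) -> (forall x, K x -> K (adj T x)) ->
  forall y, q (T y) = T (q y).
Proof.
move=> bT bq sq Kq qK KT KT' y.
have h z : q (T (q z)) = T (q z) by apply/qK/KT/Kq.
have h' z : q (adj T (q z)) = adj T (q z) by apply/qK/KT'/Kq.
rewrite -h; apply: rip_ext => z.
by rewrite !(ripA _ _ bq) !(ripA _ _ bT) (ripA _ _ bq) sq h'.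
Qed.

Variable B : set (H -> H).
Hypothesis fB : Defs.factor B.

Lemma factor_vN : von_neumann_algebra B.
Proof. by case: fB. Qed.
Let vB := factor_vN.

(** The vectors x with c B x = 0 form a
closed subspace invariant under B and under its commutant, so that the
projection onto it is in the centre, hence a scalar: the subspace is 0 or H. *)
Lemma factor_link a c : B a -> B c ->
  (forall b, B b -> forall y, c (b (a y)) = 0) -> (forall y, a y = 0) \/ (forall y, c y = 0).
Proof.
move=> Ba Bc h.
have bc := vN_bounded vB Bc.
(* The largest B-invariant subspace in the kernel of c; it contains the range of a. *)
pose K := [set x | forall b, B b -> c (b x) = 0].
have [||||q [bq sq Kq qK]] := @projection_exists _ _ K.
- by move=> b Bb; rewrite (op0 (vN_bounded vB Bb)) (op0 bc).
- move=> x y Kx Ky b Bb.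
  by rewrite (opD (vN_bounded vB Bb)) (opD bc) Kx// Ky// addr0.
- move=> t x Kx b Bb.
  by rewrite (opZ (vN_bounded vB Bb)) (opZ bc) Kx// scaler0.
- move=> l hl b Bb; have bcb := bounded_comp bc (vN_bounded vB Bb).
  have [C C0 hC] := bounded_bound bcb.
  apply/nr_eq0/eqP; rewrite eq_le nr_ge0 andbT leNgt; apply/negP => n0.
  have [k Kk lk] := hl _ (divr_gt0 n0 C0).
  move: lk; rewrite ltr_pdivlMr// => lk.
  have := hC (k - l); rewrite (opB bcb) /= (Kk _ Bb) sub0r nrN; lra.
have qB' : commutant B q.
  split=> // U BU; apply/funext => y /=.
  apply: (invariant_projection (vN_bounded vB BU) bq sq Kq qK).
    by move=> x Kx b Bb; exact: (Kx _ (vN_comp vB Bb BU)).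
  by move=> x Kx b Bb; exact: (Kx _ (vN_comp vB Bb (vN_adj vB BU))).
have qB : B q.
  apply: (vN_bicommutant vB bq) => U cU y.
  have inv V : commutant B V -> forall x, K x -> K (V x).
    move=> cV x Kx b Bb.
    by rewrite -(commutantE _ cV Bb) -(commutantE _ cV Bc) (Kx _ Bb) (op0 cV.1).
  apply: (invariant_projection cU.1 bq sq Kq qK); first exact: inv.
  by apply: inv; exact: commutant_adj.
have [t qt] : scalar_ops q by case: fB => _ _ <-.
have [t0|t0] := eqVneq t 0.
  left=> y; have Ka : K (a y) by move=> b Bb; exact: h.
  by rewrite -(qK _ Ka) qt t0 scale0r.
right=> y.
have := Kq y; rewrite qt => /(_ _ (vN_id vB)) /=.
by rewrite (opZ bc) => /eqP; rewrite scaler_eq0 (negbTE t0) => /eqP.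
Qed.

(** By [factor_link] some c b a is non-zero.  Its polar part works: c on the left and
a on the right fix all the iterates, hence their limit. *)
Lemma link_isometry a c : B a -> B c -> a \o a = a -> c \o c = c -> adj a = a -> adj c = c ->
  (exists y, a y != 0) -> (exists y, c y != 0) ->
  exists w, [/\ B w, (forall y, w (adj w (w y)) = w y), (forall y, w (a y) = w y),
     (forall y, c (w y) = w y) & exists y, w y != 0].
Proof.
move=> Ba Bc aa cc sa sc [ya ya0] [yc yc0].
have [b [Bb [y0 hy0]]] : exists b, B b /\ exists y, c (b (a y)) != 0.
  apply: contrapT => hn.
  have [b Bb y||] := factor_link Ba Bc; last 2 first.
  - by move=> /(_ ya) /eqP; rewrite (negbTE ya0).
  - by move=> /(_ yc) /eqP; rewrite (negbTE yc0).
  apply/eqP/negP => /negP e; apply: hn; exists b; split=> //.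
  by exists y.
have BX : B (c \o (b \o a)) by exact: (vN_comp vB Bc (vN_comp vB Bb Ba)).
have bX := vN_bounded vB BX.
have [k k0 hk] := scale_contractive bX (ltr01 : 0 < 1 :> R).
pose X y := k%:C *: c (b (a y)).
have BX' : B X by exact: (vN_scale vB).
have cX : contractive X.
  by split; [exact: vN_bounded BX'|move=> y; apply: le_trans (hk y) _; rewrite mul1r].
have bc := vN_bounded vB Bc.
have ba := vN_bounded vB Ba.
have cXX y : c (X y) = X y.
  by rewrite /X (opZ bc); congr (_ *: _); exact: (congr1 (fun f => f _) cc).
have Xa y : X (a y) = X y.
  by rewrite /X; congr (_ *: c (b _)); exact: (congr1 (fun f => f _) aa).
have aXX y : a (adj X y) = adj X y.
  by apply: rip_ext => z; rewrite (ripA _ _ ba) sa !(ripA' _ _ cX.1) Xa.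
have [w [cw Xw Aw www [_ wX]]] := polar_decomposition cX.
(* A left factor fixing Y fixes all iterates of Y, hence the limit. *)
have fix_lim (Y u p : H -> H) : contractive Y -> bounded_op p -> sot \oo (ns_iter Y) u ->
    (forall y, p (Y y) = Y y) -> forall y, p (u y) = u y.
  move=> cY bp Yu pY y.
  have h : tends \oo (fun k => ns_iter Y k y) (p (u y)).
    apply: tends_eq (tends_op bp (Yu y)); apply: filterS filterT => i _ /=.
    by have [P _ e] := ns_iter_factor i cY; rewrite e pY.
  by apply: (tends_unique h (Yu y)).
exists w; split=> //.
- by apply: (vN_sot vB _ Xw cw.1) => i; exact: vN_ns_iter.
- move=> y; apply: rip_ext => z.
  have := fix_lim _ _ _ (contractive_adj cX) ba Aw aXX z => e.
  by rewrite !(ripA _ _ cw.1) (ripA _ _ ba) sa e.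
- exact: (fix_lim _ _ _ cX bc Xw cXX).
- exists (adj w (X y0)); rewrite wX /X scaler_eq0 negb_or hy0 andbT.
  exact: realC_neq0.
Qed.

End FactorLink.

(** * Maximal normalising partial isometries *)

Section PartialIsometries.
Context {R : realType} {H : hilbertType R}.
Implicit Types (x y : H) (r : R) (S T U V X v w z n b : H -> H).

Definition partial_isometry z := bounded_op z /\ forall y, z (adj z (z y)) = z y.

Lemma partial_isometry_adj z : partial_isometry z -> partial_isometry (adj z).
Proof.
move=> [bz pz]; split; first exact: bounded_adj.
move=> y; apply: rip_ext => x; rewrite (adjK bz).
by rewrite !(ripA' _ _ bz) (ripA _ _ bz) (ripA' _ _ bz) pz.
Qed.

Lemma partial_isometry_contractive z : partial_isometry z -> contractive z.
Proof.
move=> [bz pz]; split=> // y.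
have e : rip (adj z (z y)) (adj z (z y)) = rip (z y) (z y).
  by rewrite (ripA' _ _ bz) pz.
have := rip_le (adj z (z y)) y; rewrite (ripA' _ _ bz).
have -> : nr (adj z (z y)) = nr (z y).
  by apply/eqP; rewrite eq_le !le_nr// e.
rewrite -nr_sqr; have := nr_ge0 (z y); have := nr_ge0 y; nra.
Qed.

(** The extension order on partial isometries, z' (z† z) = z and (z z†) z' = z, in
an equivalent form that is visibly invariant under taking adjoints. *)
Definition extends z z' := (forall y, z' (adj z y) = z (adj z y)) /\
  (forall y, adj z (z' y) = adj z (z y)).

Lemma extends_refl z : extends z z.
Proof. by []. Qed.

Lemma extends_adj z z' : bounded_op z -> bounded_op z' ->
  extends z z' -> extends (adj z) (adj z').
Proof.
move=> bz bz' [h1 h2]; split=> y; apply: rip_ext => x; rewrite (adjK bz).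
- by rewrite (ripA' _ _ bz') (ripA _ _ bz) h2 (ripA' _ _ bz) (ripA _ _ bz).
- by rewrite !(ripA _ _ bz) (ripA' _ _ bz') h1 (ripA' _ _ bz).
Qed.

(** By invariance under adjoints, one half of the conclusion suffices; for it,
the range of z† is fixed by z'† z'. *)
Lemma extends_trans z z' z'' : partial_isometry z -> bounded_op z' -> bounded_op z'' ->
  extends z z' -> extends z' z'' -> extends z z''.
Proof.
have half (u u' u'' : H -> H) : partial_isometry u -> bounded_op u' -> bounded_op u'' ->
    extends u u' -> extends u' u'' -> forall y, u'' (adj u y) = u (adj u y).
  move=> pu bu' bu'' h h' y; have [h1 h2] := extends_adj pu.1 bu' h.
  have [_ pa] := partial_isometry_adj pu.
  have e : adj u y = adj u' (u' (adj u y)).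
    by rewrite h.1 -[LHS]pa (adjK pu.1); move: h1; rewrite (adjK pu.1) => ->.
  by rewrite e h'.1 -e h.1.
move=> pz bz' bz'' h h'; split; first exact: half h h'.
have bz := pz.1.
have e := half _ _ _ (partial_isometry_adj pz) (bounded_adj bz') (bounded_adj bz'')
  (extends_adj bz bz' h) (extends_adj bz' bz'' h').
rewrite (adjK bz) in e.
move=> y; apply: rip_ext => x.
by rewrite !(ripA' _ _ bz) (ripA _ _ bz'') e (ripA _ _ bz).
Qed.

Lemma extends_restr z z' : partial_isometry z -> extends z z' ->
  forall y, z y = z' (adj z (z y)).
Proof. by move=> pz h y; rewrite h.1 pz.2. Qed.

Lemma extends_antisym z z' : partial_isometry z -> partial_isometry z' ->
  extends z z' -> extends z' z -> z = z'.
Proof.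
move=> pz pz' h h'; apply/funext => y.
have [h1 _] := extends_adj pz.1 pz'.1 h; rewrite (adjK pz.1) in h1.
by rewrite (extends_restr pz h) -h1 h'.2 pz'.2.
Qed.

Lemma extends_dist z z' y : bounded_op z -> extends z z' ->
  rip (z' y - z y) (z' y - z y) <= rip (z' y) (z' y) - rip (z y) (z y).
Proof.
move=> bz h.
have e : rip (z y) (z' y) = rip (z y) (z y) by rewrite (ripA _ _ bz) h.2 -(ripA _ _ bz).
by rewrite !ripE [rip (z' y) (z y)]ripC e; lra.
Qed.

Variables B M : set (H -> H).
Hypothesis vB : von_neumann_algebra B.
Hypothesis vM : von_neumann_algebra M.

Definition normalising_isometry z := partial_isometry z /\ normaliser M B z.

(** The limit of a chain exists by [monotone_tends] applied to the chain and to its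
adjoints.  It stays a normaliser because conjugation of b by a bounded family
is strongly continuous when the adjoints converge as well. *)
Lemma chain_bound (A : set (H -> H)) : A !=set0 ->
  (forall z, A z -> normalising_isometry z) -> total_on A extends ->
  exists2 L, normalising_isometry L & forall z, A z -> extends z L.
Proof.
move=> [z0 Az0] PA tot.
pose I := {z | A z}.
(* The filter generated by the tails of the chain. *)
pose F : set_system I := [set S | exists i : I, forall j : I, extends (sval i) (sval j) -> S j].
have pi (i : I) : partial_isometry (sval i) by exact: (PA _ (svalP i)).1.
have ci (i : I) := partial_isometry_contractive (pi i).
have trans (i j k : I) : extends (sval i) (sval j) -> extends (sval j) (sval k) ->
    extends (sval i) (sval k) by exact: extends_trans (pi i) (pi j).1 (pi k).1.
have totI (i j : I) : extends (sval i) (sval j) \/ extends (sval j) (sval i).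
  exact: tot (svalP i) (svalP j).
have FF : ProperFilter F.
  apply: Build_ProperFilter_ex.
    by move=> S [i h]; exists i; exact: h.
  split; first by exists (exist _ z0 Az0).
    move=> S T [i hi] [j hj]; have [ij|ji] := totI i j.
      by exists j => k jk; split; [apply: hi; exact: trans jk|exact: hj].
    by exists i => k ik; split; [exact: hi|apply: hj; exact: trans ik].
  by move=> S T ST [i hi]; exists i => j /hi /ST.
have Fup (i : I) : F [set j | extends (sval i) (sval j)] by exists i.
have Fupa (i : I) : F [set j | extends (adj (sval i)) (adj (sval j))].
  by exists i => j; exact: extends_adj (pi i).1 (pi j).1.
have bnd T y : contractive T -> rip (T y) (T y) <= rip y y.
  by move=> cT; rewrite -!nr_sqr ler_sqr ?nnegrE ?nr_ge0//; exact: cT.2.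
have [L zL] : exists L, sot F (fun i : I => sval i) L.
  suff /choice[v hv] : forall y, exists l, tends F (fun i : I => sval i y) l by exists v.
  move=> y; apply: (@monotone_tends _ _ _ _ _ (fun i j : I => extends (sval i) (sval j)) _ (rip y y)) => //.
    by move=> i j ij; exact: extends_dist (pi i).1 ij.
  by move=> i; exact: bnd.
have [L' zL'] : exists L, sot F (fun i : I => adj (sval i)) L.
  suff /choice[v hv] : forall y, exists l, tends F (fun i : I => adj (sval i) y) l by exists v.
  move=> y; apply: (@monotone_tends _ _ _ _ _
    (fun i j : I => extends (adj (sval i)) (adj (sval j))) _ (rip y y)) => //.
    move=> i j; have [ij|ji] := totI i j.
      by left; exact: extends_adj (pi i).1 (pi j).1 ij.
    by right; exact: extends_adj (pi j).1 (pi i).1 ji.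
    by move=> i j ij; exact: extends_dist (bounded_adj (pi i).1) ij.
  by move=> i; apply: bnd; exact: contractive_adj.
have cL : contractive L by apply: (sot_contractive ci zL).
have cL' : contractive L' by apply: (sot_contractive (fun i => contractive_adj (ci i)) zL').
have aL : adj L = L' by apply: (sot_adj (fun i => (ci i).1) cL.1 cL'.1 zL zL').
rewrite -aL in zL'.
have bA := bounded_adj cL.1.
exists L; last first.
  move=> z Az; pose i : I := exist _ z Az.
  split=> y.
    have h : tends F (fun j : I => sval j (adj z y)) (z (adj z y)).
      apply: (tends_eq _ (@tends_cst _ _ _ F _ _)).
      by apply: filterS (Fup i) => j [h1 h2] /=; rewrite (h1, h2).
    by apply: (tends_unique (zL _) h).
  have h : tends F (fun j : I => adj z (sval j y)) (adj z (z y)).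
    apply: (tends_eq _ (@tends_cst _ _ _ F _ _)).
    by apply: filterS (Fup i) => j [h1 h2] /=; rewrite (h1, h2).
  by apply: (tends_unique (tends_op (bounded_adj (pi i).1) (zL y)) h).
split.
  split; first exact: cL.1.
  move=> y.
  have h : sot F (fun i : I => sval i \o (adj (sval i) \o sval i)) (L \o (adj L \o L)).
    by apply: (sot_comp ci zL (sot_comp (fun i => contractive_adj (ci i)) zL' zL)).
  apply: (tends_unique (h y)).
  by apply: (tends_eq _ (zL y)); apply: filterS filterT => i _ /=; rewrite (pi i).2.
split.
  by apply: (vN_sot vM _ zL cL.1) => i; exact: (PA _ (svalP i)).2.1.
move=> b Bb; have bb := vN_bounded vB Bb; split.
- have h : sot F (fun i : I => sval i \o (b \o adj (sval i))) (L \o (b \o adj L)).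
    by apply: (sot_comp ci zL (sot_compl bb zL')).
  apply: (vN_sot vB _ h); last exact: (bounded_comp cL.1 (bounded_comp bb bA)).
  by move=> i; have [_ [_ /(_ _ Bb) []]] := PA _ (svalP i).
- have h : sot F (fun i : I => adj (sval i) \o (b \o sval i)) (adj L \o (b \o L)).
    by apply: (sot_comp (fun i => contractive_adj (ci i)) zL' (sot_compl bb zL)).
  apply: (vN_sot vB _ h); last exact: (bounded_comp bA (bounded_comp bb cL.1)).
  by move=> i; have [_ [_ /(_ _ Bb) []]] := PA _ (svalP i).
Qed.

Lemma maximal_extension v : normalising_isometry v ->
  exists z, [/\ normalising_isometry z, extends v z &
    forall z', normalising_isometry z' -> extends z z' -> z' = z].
Proof.
move=> Nv.
(* Restricting to extensions of v makes v a bound of the empty chain. *)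
pose J := {z | normalising_isometry z /\ extends v z}.
pose leJ (s t : J) : bool := `[< extends (sval s) (sval t) >].
have Nj (s : J) : normalising_isometry (sval s) by exact: (svalP s).1.
have [|||A tot|z zmax] := @Zorn J leJ.
- by move=> t; apply/asboolP; exact: extends_refl.
- move=> r s t /asboolP rs /asboolP st; apply/asboolP.
  exact: extends_trans (Nj r).1 (Nj s).1.1 (Nj t).1.1 rs st.
- move=> s t /asboolP st /asboolP ts.
  have := extends_antisym (Nj s).1 (Nj t).1 st ts.
  by case: s t {st ts} => [s Ps] [t Pt] /=; exact: eq_exist.
- have [->|A0] := eqVneq A set0; first by exists (exist _ v (conj Nv (extends_refl v))).
  have [s0 As0] : A !=set0 by exact/set0P.
  have [|||L NL hL] := @chain_bound [set sval s | s in A].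
  + by exists (sval s0), s0.
  + by move=> _ [s _ <-].
  + by move=> _ _ [s As <-] [t At <-]; have [/asboolP|/asboolP] := tot _ _ As At; [left|right].
  have vL : extends v L.
    apply: (extends_trans Nv.1 (Nj s0).1.1 NL.1.1 (svalP s0).2).
    by apply: hL; exists s0.
  exists (exist _ L (conj NL vL)) => s As; apply/asboolP.
  by apply: hL; exists s.
exists (sval z); split; [exact: Nj|exact: (svalP z).2|].
move=> z' Nz' zz'.
have vz' : extends v z' by exact: extends_trans Nv.1 (Nj z).1.1 Nz'.1.1 (svalP z).2 zz'.
have := zmax (exist _ z' (conj Nz' vz')) => /(_ (asboolT zz')).
by move/(congr1 sval).
Qed.

End PartialIsometries.

(** * Extension to unitary normalisers *)

Section Main.
Context {R : realType} {H : hilbertType R}.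
Implicit Types (x y : H) (r : R) (S T U V X v w z n b : H -> H).
Variables B M : set (H -> H).
Hypothesis fB : Defs.factor B.
Hypothesis vM : von_neumann_algebra M.
Hypothesis finM : finite_projection M idfun.
Hypothesis BM : B `<=` M.
Let vB := factor_vN fB.

(** Finiteness of M is used here: an isometry of M makes 1 equivalent to its range
projection. *)
Lemma isometry_coisometry z : M z -> (forall y, adj z (z y) = y) -> forall y, z (adj z y) = y.
Proof.
move=> Mz iz y; have bz := vN_bounded vM Mz; have bA := bounded_adj bz.
have /(congr1 (fun f => f y)) // : z \o adj z = idfun.
apply: finM.2 => //.
- split; first exact: (vN_comp vM Mz (vN_adj vM Mz)).
    by apply/funext => u /=; rewrite iz.
  by rewrite adj_comp// adjK.
- by exists z => //; split=> //; apply/funext => u /=; rewrite iz.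
Qed.

(** The cross terms in z' b z'† are of the form z (b w) z† w1† and w1 z (w† b) z†:
they are in B because z normalises all of B, and not just a corner of it.  The
last hypothesis puts the initial projection of w1 below z w† w z†, so that
w1 z w† is a partial isometry. *)
Lemma proper_extension z w w1 : normalising_isometry B M z -> B w -> B w1 ->
  (forall y, z (w y) = 0) -> (forall y, adj z (w1 y) = 0) ->
  (forall y, w1 (adj w1 (w1 y)) = w1 y) ->
  (forall y, w1 (z (adj w (w (adj z y)))) = w1 y) ->
  let z' := fun y => z y + w1 (z (adj w y)) in
  normalising_isometry B M z' /\ extends z z'.
Proof.
move=> [[bz pz] [Mz Nz]] Bw Bw1 zw zw1 pw1 w1g z'.
have bw := vN_bounded vB Bw; have bw1 := vN_bounded vB Bw1.
have bA := bounded_adj bz; have baw := bounded_adj bw.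
have wz y : adj w (adj z y) = 0.
  by apply: rip_ext => x; rewrite (ripA' _ _ bw) (ripA' _ _ bz) zw rip0l rip0r.
have w1z y : adj w1 (z y) = 0.
  by apply: rip_ext => x; rewrite (ripA' _ _ bw1) (ripA _ _ bz) zw1 rip0l rip0r.
have bz' : bounded_op z' by exact: bounded_add bz (bounded_comp bw1 (bounded_comp bz baw)).
have az' : adj z' = fun y => adj z y + w (adj z (adj w1 y)).
  apply: adj_uniq => //.
    exact: bounded_add bA (bounded_comp bw (bounded_comp bA (bounded_adj bw1))).
  move=> x y; rewrite /z' ripDl ripDr (ripA _ _ bz) (ripA _ _ bw1) (ripA _ _ bz).
  by rewrite (ripA' _ _ bw).
split; last first.
  split=> y; rewrite /z'.
    by rewrite wz (op0 bz) (op0 bw1) addr0.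
  by rewrite (opD bA) zw1 addr0.
split; first split=> // y.
  rewrite az' /z'.
  rewrite !(opD bA) zw1 addr0 (opD (bounded_adj bw1)) w1z add0r.
  rewrite (opD bz) pz zw addr0 (opD baw) wz add0r.
  by rewrite w1g pw1.
split.
  apply: (vN_add vM Mz); apply: (vN_comp vM (BM Bw1)).
  by apply: (vN_comp vM Mz); apply: (vN_adj vM (BM Bw)).
have Ba := vN_adj vB.
have comp3 S T U : B S -> B T -> B U -> B (S \o T \o U).
  by move=> BS BT BU; exact: (vN_comp vB (vN_comp vB BS BT) BU).
move=> b Bb; have bb := vN_bounded vB Bb; rewrite az'.
have conj1 T : B T -> B (z \o T \o adj z) by move=> BT; have [] := Nz T BT.
have conj2 T : B T -> B (adj z \o T \o z) by move=> BT; have [] := Nz T BT.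
split.
- have := vN_add vB
    (vN_add vB (conj1 _ Bb) (vN_comp vB (conj1 _ (vN_comp vB Bb Bw)) (Ba _ Bw1)))
    (vN_add vB (vN_comp vB Bw1 (conj1 _ (vN_comp vB (Ba _ Bw) Bb)))
       (comp3 _ _ _ Bw1 (conj1 _ (comp3 _ _ _ (Ba _ Bw) Bb Bw)) (Ba _ Bw1))).
  congr B; apply/funext => y; rewrite /z' /=.
  by rewrite !(opD bb) (opD bz) !(opD baw) (opD bz) (opD bw1).
- have := vN_add vB
    (vN_add vB (conj2 _ Bb) (vN_comp vB (conj2 _ (vN_comp vB Bb Bw1)) (Ba _ Bw)))
    (vN_add vB (vN_comp vB Bw (conj2 _ (vN_comp vB (Ba _ Bw1) Bb)))
       (comp3 _ _ _ Bw (conj2 _ (comp3 _ _ _ (Ba _ Bw1) Bb Bw1)) (Ba _ Bw))).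
  congr B; apply/funext => y; rewrite /z' /=.
  by rewrite !(opD bb) (opD bA) !(opD (bounded_adj bw1)) (opD bA) (opD bw).
Qed.

(** If z is not unitary then, M being finite, neither 1 - z† z nor 1 - z z† vanishes.
Two applications of [link_isometry] then yield w and w1 as in
[proper_extension], contradicting maximality. *)
Lemma maximal_unitary z : normalising_isometry B M z -> (exists y, z y != 0) ->
  (forall z', normalising_isometry B M z' -> extends z z' -> z' = z) -> unitary z.
Proof.
move=> Nz [y0 zy0] zmax.
have [[bz pz] [Mz NBz]] := Nz.
have bA := bounded_adj bz.
suff [iz | iz] : (forall y, adj z (z y) = y) \/ (forall y, z (adj z y) = y).
- split; apply/funext => y /=; [exact: iz|exact: isometry_coisometry].
- split; apply/funext => y /=; last exact: iz.
  rewrite -[X in adj z (X y)](adjK bz); apply: isometry_coisometry.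
    exact: (vN_adj vM).
  by rewrite (adjK bz).
apply: contrapT => /not_orP[/existsNP[y1 /eqP y1P] /existsNP[y2 /eqP y2P]].
have [_ paz] := partial_isometry_adj (proj1 Nz); rewrite (adjK bz) in paz.
pose e := adj z \o z; pose f := z \o adj z.
have Be : B e by have [_] := NBz _ (vN_id vB).
have Bf : B f by have [] := NBz _ (vN_id vB).
have be := vN_bounded vB Be; have bf := vN_bounded vB Bf.
have se : adj e = e by rewrite /e adj_comp// adjK.
have sf : adj f = f by rewrite /f adj_comp// adjK.
have ee y : e (e y) = e y by rewrite /e /= pz.
have ff y : f (f y) = f y by rewrite /f /= paz.
have compl p : bounded_op p -> adj p = p -> (forall y, p (p y) = p y) ->
    (fun y => y - p y) \o (fun y => y - p y) = (fun y => y - p y) /\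
    adj (fun y => y - p y) = (fun y => y - p y).
  move=> bp sp pp; split.
    by apply/funext => y /=; rewrite (opB bp) pp subrr subr0.
  have bq : bounded_op (fun y => y - p y).
    have := bounded_add bounded_id (bounded_scale (-1) bp).
    by congr bounded_op; apply/funext => y; rewrite scaleN1r.
  by apply: adj_uniq => // x y; rewrite !ripE (ripA _ _ bp) sp.
have [ce1 ce2] := compl e be se ee.
have [cf1 cf2] := compl f bf sf ff.
have [||||||||w [Bw pw we w1e [yw wyw]]] := @link_isometry _ _ B fB e (fun y => y - e y) => //.
- exact: (vN_sub vB (vN_id vB)).
- by apply/funext => y /=; rewrite ee.
- by exists y0; apply: contra zy0 => /eqP h; rewrite -pz -/(e y0) -[adj z _]/(e y0) h (op0 bz).
- by exists y1; rewrite subr_eq0 eq_sym.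
have bw := vN_bounded vB Bw.
have zw y : z (w y) = 0 by rewrite -w1e (opB bz) pz subrr.
have ew y : e (adj w y) = adj w y.
  by apply: rip_ext => x; rewrite (ripA _ _ be) se !(ripA' _ _ bw) we.
(* The image under z of the initial projection of w. *)
pose g := z \o (adj w \o w) \o adj z.
have Bg : B g by have [] := NBz _ (vN_comp vB (vN_adj vB Bw) Bw).
have [||||||||w1 [Bw1 pw1 w1g w1f [yw1 wyw1]]] := @link_isometry _ _ B fB g (fun y => y - f y) => //.
- exact: (vN_sub vB (vN_id vB)).
- by apply/funext => y; rewrite /g /= -/(e _) -[adj z (z _)]/(e _) ew pw.
- apply: adj_uniq; try exact: vN_bounded Bg.
  move=> x y; rewrite /g /= (ripA _ _ bz) (ripA' _ _ bw) (ripA _ _ bw).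
  exact: ripA'.
- exists (z yw); apply/negP => /eqP h; move/negP: wyw; apply.
  have : w (adj z (g (z yw))) = w yw.
    by rewrite /g /= -[adj z (z (adj w _))]/(e (adj w _)) ew pw -[adj z (z yw)]/(e yw) we.
  by rewrite h (op0 bA) (op0 bw) => <-.
- by exists y2; rewrite subr_eq0 eq_sym.
have bw1 := vN_bounded vB Bw1.
have zw1 y : adj z (w1 y) = 0 by rewrite -w1f (opB bA) paz subrr.
have [Nz' zz'] := proper_extension Nz Bw Bw1 zw zw1 pw1 w1g.
have /(congr1 (fun h => h (w (adj z yw1)))) := zmax _ Nz' zz'.
rewrite -[RHS]addr0 => /addrI; move: (w1g yw1); rewrite /g /= => -> h.
by move: wyw1; rewrite h eqxx.
Qed.

(** T commutes with B, hence with v† v and v† n in the factorisation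
n = u (v† v) (v† n), and with u by hypothesis.  The operator n is first scaled to a
contraction m. *)
Lemma normaliser_commute T n : bounded_op T ->
  (forall u, unitary_normaliser M B u -> forall y, T (u y) = u (T y)) ->
  normaliser M B n -> forall y, T (n y) = n (T y).
Proof.
move=> bT TU Nn y.
have TB : forall b, B b -> forall y, T (b y) = b (T y).
  apply: (commute_unitaries vB bT) => u Bu uu; apply: TU; split=> //; first exact: BM.
  case: uu => u1 u2; apply/seteqP; split=> [_ [b Bb <-]|b Bb].
    exact: (vN_comp vB (vN_comp vB Bu Bb) (vN_adj vB Bu)).
  exists (adj u \o b \o u); first exact: (vN_comp vB (vN_comp vB (vN_adj vB Bu) Bb) Bu).
  have e x : u (adj u x) = x by exact: (congr1 (fun f => f x) u2).
  by apply/funext => x /=; rewrite !e.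
have bn := vN_bounded vM Nn.1.
have [k k0 hk] := scale_contractive bn (ltr01 : 0 < 1 :> R).
pose m y := k%:C *: n y.
have bm : bounded_op m by exact: bounded_scale.
have cm : contractive m by split=> // x; apply: le_trans (hk x) _; rewrite mul1r.
have Nm : normaliser M B m.
  split; first exact: (vN_scale vM _ Nn.1).
  move=> b Bb; have [h1 h2] := Nn.2 b Bb; have bb := vN_bounded vB Bb.
  have am : adj m = fun y => k%:C *: adj n y by rewrite /m adj_scale// conjc_real.
  rewrite am; split.
    have := vN_scale vB (k%:C) (vN_scale vB (k%:C) h1).
    by congr B; apply/funext => x; rewrite /m /= (opZ bb) (opZ bn).
  have := vN_scale vB (k%:C) (vN_scale vB (k%:C) h2).
  by congr B; apply/funext => x; rewrite /m /= (opZ bb) (opZ (bounded_adj bn)).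
apply: (scalerI (realC_neq0 k0)); rewrite -(opZ bT) -/(m y) -/(m (T y)).
have [/existsNP[x0 /eqP mx0]|m0] := pselect (~ forall x, m x = 0); last first.
  by move/contrapT : m0 => m0; rewrite !m0 (op0 bT).
have [v [cv mv mv' pv [_ vm]]] := polar_decomposition cm.
have [Nv Bh] := normaliser_polar vB vM cm Nm cv mv mv'.
have NIv : normalising_isometry B M v by split=> //; split=> //; exact: cv.1.
have [z [Nz vz zmax]] := maximal_extension vB vM NIv.
have rz := extends_restr NIv.1 vz.
have uz : unitary z.
  apply: maximal_unitary => //; exists (adj v (v (adj v (m x0)))).
  by rewrite -rz vm.
have Uz : unitary_normaliser M B z.
  case: uz => z1 z2; case: Nz => _ [Mz Nz]; split=> //.
  apply/seteqP; split=> [_ [b Bb <-]|b Bb]; first by have [] := Nz b Bb.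
  exists (adj z \o b \o z); first by have [] := Nz b Bb.
  have e x : z (adj z x) = x by exact: (congr1 (fun f => f x) z2).
  by apply/funext => x /=; rewrite !e.
have Be : B (adj v \o v) by have [_] := Nv.2 _ (vN_id vB).
have mE x : m x = z ((adj v \o v) ((adj v \o m) x)) by rewrite /= -rz vm.
by rewrite !mE (TU _ Uz) (TB _ Be) (TB _ Bh).
Qed.

End Main.

Theorem theorem3p13 (R : realType) (H : hilbertType R) (B M : set (H -> H)) :
  II1_factor B -> II1_factor M -> B `<=` M ->
  regular M B -> unitarily_regular M B.
Proof.
move=> [fB _] [[_ vM _] [finM _]] BM regB.
apply/seteqP; split.
  move=> T; apply; split=> //; by move=> u [].
move=> T MT P [vP UP PM]; move: MT; rewrite -[X in X T]regB; apply; split=> // n Nn.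
apply: (vN_bicommutant vP (vN_bounded vM Nn.1)) => U cU y.
apply/esym; apply: (normaliser_commute fB vM finM BM cU.1 _ Nn) => u Uu x.
exact: (commutantE _ cU (UP _ Uu)).
Qed.
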